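(* Let $E\subseteq\mathbb{R}^{n+1}$ be a nonempty $(c_0,\delta_0,\Phi)$-weakly porous set for $c_0,\delta_0\in(0,1)$. Then $E$ is also $\alpha$-improving for some $\alpha=\alpha(n,p,d,c_0,\delta_0)>0$.
   Context: Throughout, $n\ge 1$ is an integer, $1<p<\infty$, and $d\ge1$ is a fixed integer with $dp\ge\log_2 9$. Points of $\mathbb{R}^{n+1}$ are written $(x,t)$ with $x\in\mathbb{R}^n$, $t\in\mathbb{R}$; $|\cdot|$ is Lebesgue measure. Fixed parameters: $\theta_0,\phi,\Phi\ge2$ are integers, fixed once and for all in terms of $p,d$, satisfying: (1) $\phi\le\Phi-\theta_0-\lceil\frac{2\theta_0}{2^{dp}-1}\rceil$; (2) $\phi\le\theta_0\le\Phi$; (3) $\Phi\ge\lceil2^{dp}\rceil-1$; (4) $\phi\le\lfloor2^{dp}\rfloor-1-\theta_0-\lceil\frac{2\theta_0}{2^{dp}-1}\rceil$; (5) $\phi-\theta_0\le-\lceil\frac{4\theta_0}{2^{dp}-1}\rceil$. (For example $\theta_0=4$, $\phi=2$, $\Phi=\lceil2^{dp}\rceil-1$.) Parabolic rectangles: for $x\in\mathbb{R}^n$, $t\in\mathbb{R}$, $L>0$, $0\le\gamma\le1/2$, let $Q(x,L)=\prod_{i}[x_i-L/2,x_i+L/2)$ and $R(\gamma)=R(x,t,L,\gamma)=Q(x,L)\times[t-L^p,t-\gamma L^p)$. Side lengths: $l_x(R(\gamma))=L$, $l_t(R(\gamma))=(1-\gamma)L^p$. For $\theta\in\mathbb{R}$,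 $R^\theta(\gamma)=R(\gamma)+(0,\theta\, l_t(R(\gamma)))$. Dyadic lattice: $\mathcal{D}_1(R(\gamma))$ is the partition of $R(\gamma)$ obtained by dividing each spatial edge into $2^d$ equal half-open intervals and the temporal edge into $k$ equal half-open intervals, where $k=\lceil 2^{dp}\rceil$ if $0\le\gamma\le 1-\frac{2^{dp}+1}{2^{dp+1}}$ and $k=\lfloor2^{dp}\rfloor$ if $1-\frac{2^{dp}+1}{2^{dp+1}}<\gamma\le\frac12$. Its members are again parabolic rectangles with truncation parameter in $[0,1/2]$. Put $\mathcal{D}_0(R(\gamma))=\{R(\gamma)\}$, $\mathcal{D}_{i+1}(R(\gamma))=\bigcup_{P\in\mathcal{D}_i(R(\gamma))}\mathcal{D}_1(P)$, $\mathcal{D}(R(\gamma))=\bigcup_{i\ge0}\mathcal{D}_i(R(\gamma))$. Weak porosity: for a nonempty closed $E$, a set $A$ is $E$-free if $A\cap E=\emptyset$. $\mathcal{F}(R(\gamma_0))$ is the collection of maximal (with respect to inclusion) $E$-free members of $\mathcal{D}(R(\gamma_0))$, and $\mathcal{M}(R(\gamma_0))\in\mathcal{F}(R(\gamma_0))$ is a member with largest $l_x$ ($\mathcal{M}(R(\gamma_0))=\emptyset$ if $\mathcal{F}(R(\gamma_0))=\emptyset$). For $c,\delta\in(0,1)$, $\theta\in\mathbb{R}$, a nonempty closed set $E$ is $(c,\delta,\theta)$-weakly porous if for every parabolic rectangle $R(\gamma_0)$ with $0\le\gamma_0\le1/2$ there are finitely many pairwise disjoint $E$-free $P_1,\dots,P_N\in\mathcal{D}(R(\gamma_0))$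 with $|P_k|\ge\delta|\mathcal{M}(R^\theta(\gamma_0))|$ for all $k$ and $\sum_{k=1}^N|P_k|\ge c|R(\gamma_0)|$. $\alpha$-improvement: a $(c_0,\delta_0,\theta)$-weakly porous set $E$ is $\alpha$-improving if there are constants $\alpha,K>0$ such that for every $0<\delta\le\delta_0$ the set $E$ is $(c,\delta,\theta)$-weakly porous for some $0<c<1$ with $1-c\le K\delta^\alpha$ (here with $\theta=\Phi$). *)

(* Defs.v *)
From HB Require Import structures.
From mathcomp Require Import all_boot all_order all_algebra.
From mathcomp Require Import all_classical all_reals all_analysis.

Set Implicit Arguments.
Unset Strict Implicit.
Unset Printing Implicit Defensive.
Import Order.TTheory GRing.Theory Num.Theory.
Import numFieldNormedType.Exports.

Local Open Scope classical_set_scope.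
Local Open Scope ring_scope.

(* Lebesgue measure on R^n and on R^n x R, as the product of n (resp. n + 1)
   copies of the one-dimensional measure: each step integrates the measure of
   the sections, which is what [product_measure1] (notation [\x]) unfolds to.
   As for [\x], the value is meaningful on measurable sets; below it is only
   applied to boxes and to the empty set. *)
Fixpoint lebesgue_row (R : realType) (n : nat) : set 'rV[R]_n -> \bar R :=
  match n return set 'rV[R]_n -> \bar R with
  | 0 => fun A => (\1_A (0 : 'rV[R]_0))%:E
  | m.+1 => fun A => (\int[@lebesgue_measure R]_x
      lebesgue_row [set v : 'rV[R]_m | A (row_mx (x%:M : 'rV[R]_1) v)])%E
  end.

Definition vol (R : realType) (n : nat) (A : set ('rV[R]_n * R)) : \bar R :=
  (\int[@lebesgue_measure R]_t lebesgue_row [set x | A (x, t)])%E.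

(* The parameters (x, t, L, gamma) of a parabolic rectangle; the constraints
   on L and gamma are in [is_prect], the underlying set is [prect_set]. *)
Record prect (R : realType) (n : nat) := PRect {
  pr_x : 'rV[R]_n;
  pr_t : R;
  pr_L : R;
  pr_gamma : R }.

Definition is_prect (R : realType) (n : nat) (P : prect R n) : Prop :=
  0 < pr_L P /\ 0 <= pr_gamma P <= 2^-1.

Definition prect_set (R : realType) (n : nat) (p : R) (P : prect R n) :
    set ('rV[R]_n * R) :=
  [set z : 'rV[R]_n * R | (forall i, pr_x P 0 i - pr_L P / 2 <= z.1 0 i
                      < pr_x P 0 i + pr_L P / 2) /\
           pr_t P - pr_L P `^ p <= z.2
             < pr_t P - pr_gamma P * pr_L P `^ p].

Definition l_t (R : realType) (n : nat) (p : R) (P : prect R n) : R :=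
  (1 - pr_gamma P) * pr_L P `^ p.

Definition prect_shift (R : realType) (n : nat) (p theta : R)
    (P : prect R n) : prect R n :=
  PRect (pr_x P) (pr_t P + theta * l_t p P) (pr_L P) (pr_gamma P).

Definition two_dp (R : realType) (p : R) (d : nat) : R := 2 `^ (d%:R * p).

Definition tdiv (R : realType) (p : R) (d : nat) (gamma : R) : nat :=
  let k : int := if gamma <= 1 - (two_dp p d + 1) / 2 `^ (d%:R * p + 1)
                 then Num.ceil (two_dp p d) else Num.floor (two_dp p d) in
  `|k|%N.

(* The piece of P whose i-th spatial edge is the (j i)-th of the 2^d equal
   parts of that of P, and whose temporal edge is the m-th of the k equal parts
   of that of P. A parabolic rectangle of side L' and temporal interval
   [b, b + h) has t = b + L'^p and gamma = 1 - h / L'^p. *)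
Definition prect_child (R : realType) (n : nat) (p : R) (d : nat)
    (P : prect R n) (j : 'I_n -> 'I_(2 ^ d))
    (m : 'I_(tdiv p d (pr_gamma P))) : prect R n :=
  let L' := pr_L P / 2 ^+ d in
  let h := l_t p P / (tdiv p d (pr_gamma P))%:R in
  let b := pr_t P - pr_L P `^ p + m%:R * h in
  PRect (\row_i (pr_x P 0 i - pr_L P / 2 + ((j i)%:R + 2^-1) * L'))
        (b + L' `^ p) L' (1 - h / L' `^ p).

Definition dyadic1 (R : realType) (n : nat) (p : R) (d : nat)
    (P : prect R n) : set (prect R n) :=
  [set Q | exists j m, Q = @prect_child R n p d P j m].

Fixpoint dyadic_level (R : realType) (n : nat) (p : R) (d i : nat)
    (P : prect R n) : set (prect R n) :=
  match i with
  | 0 => [set P]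
  | i'.+1 => \bigcup_(Q in dyadic_level p d i' P) dyadic1 p d Q
  end.

Definition dyadic (R : realType) (n : nat) (p : R) (d : nat)
    (P : prect R n) : set (prect R n) :=
  \bigcup_i dyadic_level p d i P.

Definition is_free (T : Type) (E A : set T) : Prop := A `&` E = set0.

Definition max_free (R : realType) (n : nat) (p : R) (d : nat)
    (E : set ('rV[R]_n * R)) (P : prect R n) : set (prect R n) :=
  [set Q | [/\ dyadic p d P Q, is_free E (prect_set p Q) &
    forall Q', dyadic p d P Q' -> is_free E (prect_set p Q') ->
      prect_set p Q `<=` prect_set p Q' -> prect_set p Q' = prect_set p Q]].

Definition largest_free (R : realType) (n : nat) (p : R) (d : nat)
    (E : set ('rV[R]_n * R)) (P : prect R n) : set ('rV[R]_n * R) :=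
  xget set0 (prect_set p @` [set Q | max_free p d E P Q /\
    forall Q', max_free p d E P Q' -> pr_L Q' <= pr_L Q]).

Definition weakly_porous (R : realType) (n : nat) (p : R) (d : nat)
    (c delta theta : R) (E : set ('rV[R]_n * R)) : Prop :=
  [/\ E !=set0, closed E &
    forall P0 : prect R n, is_prect P0 ->
    exists (N : nat) (P : 'I_N -> prect R n),
    [/\ trivIset [set: 'I_N] (fun k => prect_set p (P k)),
        forall k, dyadic p d P0 (P k) /\ is_free E (prect_set p (P k)),
        forall k, (delta%:E * vol (largest_free p d E (prect_shift p theta P0))
                     <= vol (prect_set p (P k)))%E &
        (c%:E * vol (prect_set p P0)
           <= \sum_(k < N) vol (prect_set p (P k)))%E]].

Definition alpha_improving (R : realType) (n : nat) (p : R) (d : nat)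
    (c0 delta0 theta alpha : R) (E : set ('rV[R]_n * R)) : Prop :=
  [/\ weakly_porous p d c0 delta0 theta E, 0 < alpha &
    exists2 K : R, 0 < K & forall delta : R, 0 < delta <= delta0 ->
    exists c : R, [/\ 0 < c < 1, 1 - c <= K * delta `^ alpha &
                      weakly_porous p d c delta theta E]].

Definition admissible (R : realType) (p : R) (d : nat)
    (theta0 phi Phi : int) : Prop :=
  let s := two_dp p d in
  let c2 := Num.ceil (2 * theta0%:~R / (s - 1)) in
  let c4 := Num.ceil (4 * theta0%:~R / (s - 1)) in
  [/\ [/\ 2 <= theta0, 2 <= phi & 2 <= Phi],
      phi <= Phi - theta0 - c2,
      phi <= theta0 <= Phi,
      Num.ceil s - 1 <= Phi &
      phi <= Num.floor s - 1 - theta0 - c2 /\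
      phi - theta0 <= - c4].

(* Main.v *)
(** Write Q^z for the translate of Q by z of its own temporal lengths. Weak
    porosity of Q says: if Q^Phi contains a free cell of level a, then all but a
    proportion 1 - c0 of Q is covered by free cells of level a + O(1).

    Holes propagate backwards in time. If S contains a hole, S^(-Phi) has holes of
    comparable size filling a proportion c0, hence so has every slight translate of
    S^(-Phi). Cells of spatial side 2^(-di) thus travel any spatial distance in
    O(2^(di)) steps, which take time O(2^(di(1-p))); as p > 1, this is small for
    deep cells. Hence a hole in S forces one of comparable size in every earlier
    cell near S, with constants depending only on the parameters.

    Let R^Phi contain a free cell of level L. Call a cell Q of R stopped if Q^Phi
    has no hole of level at most L + lag_depth. By propagation Q^z then contains
    no free cell of level L + O(1) for all Phi <= z <= N, with N large. In a time
    column the stopped cells therefore precede long windows filled, up to a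
    proportion Phi / N, by nonfree cells of level L + O(1); by a rising sun
    argument they and the nonfree cells of that level cover at most a proportion
    1 - c0 / 2 of R. Each maximal stopped cell Q has a hole of level L + O(1) in
    Q^Phi, so the argument restarts inside Q, and the part of R not covered by
    free cells of level L + O(J) has proportion at most (1 - c0 / 2)^J. *)

Require Import Defs.
From HB Require Import structures.
From mathcomp Require Import all_boot all_order all_algebra.
From mathcomp Require Import all_classical all_reals all_analysis.
From mathcomp Require Import zify ring lra.
Import Order.TTheory GRing.Theory Num.Theory.
Import numFieldNormedType.Exports.
Local Open Scope classical_set_scope.
Local Open Scope ring_scope.
Set Implicit Arguments.
Unset Strict Implicit.
Unset Printing Implicit Defensive.

(** * Elementary inequalities and counting along a line *)

Lemma bernoulli (R : realFieldType) (y : R) m : -1 <= y -> 1 + m%:R * y <= (1 + y) ^+ m.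
Proof.
move=> y1; elim: m => [|m IH]; first by rewrite mul0r addr0 expr0.
rewrite exprS; apply: (@le_trans _ _ ((1 + y) * (1 + m%:R * y))).
  rewrite [leRHS](_ : _ = 1 + m.+1%:R * y + m%:R * y ^+ 2); last by rewrite -natr1; ring.
  by rewrite lerDl mulr_ge0 ?sqr_ge0.
by rewrite ler_wpM2l //; lra.
Qed.

Lemma card_interior D : (D - 2 <= #|[pred x : 'I_D | (0 < x) && (x.+1 < D)]|)%N.
Proof.
case: D => [|[|D]] //; rewrite -sum1_card big_mkcond big_ord_recl big_ord_recr /=.
rewrite !inE /= /bump add1n ltnn addn0 add0n subn2 /= (eq_bigr (fun=> 1%N)); last first.
  by move=> i _; rewrite inE /= /bump add1n !ltnS ltn_ord.
by rewrite sum_nat_const card_ord muln1.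
Qed.

(* Scanning from the left, each t in A outside B is followed by a jump to the end
   of its window, of length at least N * l, of which B misses at most F * l. *)
Lemma lagged_rising_sun (A B : nat -> bool) (F N T e : nat) :
  (forall t, (t < T)%N -> A t -> B t \/ exists a l, [/\ (a <= t < a + l)%N,
     (forall t', (a + F * l <= t' < a + N.+1 * l)%N -> B t') & (N.+1 * l <= e)%N]) ->
  ((N - F) * \sum_(0 <= t < T) A t <= N * \sum_(0 <= t < T + e) B t)%N.
Proof.
move=> H.
have all1 u v : (forall t, (u <= t < v)%N -> B t) -> (v - u <= \sum_(u <= t < v) B t)%N.
  move=> h; rewrite (eq_big_nat _ _ (F2 := fun=> 1%N)) ?sum_nat_const_nat ?muln1 //.
  by move=> t /h ->.
have le1 u v : (\sum_(u <= t < v) A t <= v - u)%N.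
  rewrite -[leqRHS]muln1 -sum_nat_const_nat; apply: leq_sum => t _.
  by case: (A t).
(* Induction on the distance from the scanning position [t0] to [T]. *)
suff gen m : forall t0, (t0 + m = T)%N ->
    ((N - F) * \sum_(t0 <= t < T) A t <= N * \sum_(t0 <= t < T + e) B t)%N.
  exact: (gen T).
elim/ltn_ind: m => m IH t0 tT.
case: m => [|m] in IH tT *; first by rewrite big_geq ?muln0 //; lia.
have lt0 : (t0 < T)%N by lia.
have IH1 : ((N - F) * \sum_(t0.+1 <= t < T) A t <= N * \sum_(t0.+1 <= t < T + e) B t)%N.
  by apply: (IH m) => //; lia.
have ltTe : (t0 < T + e)%N by lia.
have [At|nAt] := boolP (A t0); last first.
  rewrite big_ltn // (negbTE nAt) add0n (leq_trans IH1) // leq_mul2l.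
  by rewrite [leqRHS]big_ltn // leq_addl orbT.
have [Bt|[a [l [h1 h2 h3]]]] := H _ lt0 At.
  rewrite big_ltn // [in leqRHS]big_ltn // At Bt !mulnDr.
  by apply: leq_add => //; rewrite !muln1 leq_subr.
set t1 := (a + N.+1 * l)%N in h2.
have t01 : (t0 < t1)%N by rewrite /t1 mulSn; lia.
have t1Te : (t1 <= T + e)%N by rewrite /t1; lia.
have lowB : (t1 - maxn t0 (a + F * l) <= \sum_(t0 <= t < t1) B t)%N.
  have [hh|hh] := leqP (maxn t0 (a + F * l)) t1; last by lia.
  set M := maxn _ _ in hh *.
  have -> : (\sum_(t0 <= t < t1) B t = \sum_(t0 <= t < M) B t + \sum_(M <= t < t1) B t)%N.
    by apply: big_cat_nat => //; exact: leq_maxl.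
  apply: leq_trans (leq_addl _ _).
  by apply: all1 => t ht; apply: h2; lia.
(* As t0 < a + l, the jump has length at least N * l, so a loss of F * l is at most the fraction F /
   N of it. *)
have arith : ((N - F) * (t1 - t0) <= N * \sum_(t0 <= t < t1) B t)%N.
  apply: leq_trans (leq_mul (leqnn N) lowB).
  have h4 : (N * l <= t1 - t0)%N by rewrite /t1 mulSn; lia.
  have h5 : (t1 - t0 - F * l <= t1 - maxn t0 (a + F * l))%N by lia.
  apply: leq_trans (leq_mul (leqnn N) h5).
  move: (t1 - t0)%N h4 => x h4; rewrite mulnBl mulnBr leq_sub2l //.
  by rewrite mulnCA leq_mul2l h4 orbT.
have -> : (\sum_(t0 <= t < T + e) B t = \sum_(t0 <= t < t1) B t + \sum_(t1 <= t < T + e) B t)%N.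
  by apply: big_cat_nat => //; exact: ltnW.
rewrite mulnDr.
(* The last window may run past [T]; the extra [e] in the range of B accommodates it. *)
have [t1T|Tt1] := ltnP t1 T.
  have -> : (\sum_(t0 <= t < T) A t = \sum_(t0 <= t < t1) A t + \sum_(t1 <= t < T) A t)%N.
    by apply: big_cat_nat; exact: ltnW.
  rewrite mulnDr leq_add //.
    by apply: leq_trans arith; rewrite leq_mul2l le1 orbT.
  by apply: (IH (T - t1)%N); lia.
apply: leq_trans (leq_addr _ _); apply: leq_trans arith.
by rewrite leq_mul2l (leq_trans (le1 _ _)) ?orbT // leq_sub2r.
Qed.

(** * Sums over grids and volumes of boxes *)

Lemma sum_ord_mul a b (F : nat -> nat) :
  (\sum_(t < a * b) F t = \sum_(t1 < a) \sum_(t2 < b) F (b * t1 + t2))%N.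
Proof.
elim: a => [|a IH]; first by rewrite mul0n !big_ord0.
rewrite big_ord_recr /= -IH mulSn addnC big_split_ord /=; congr addn.
by rewrite mulnC.
Qed.

Lemma sum_ffun_mul n a b (F : ('I_n -> nat) -> nat) :
  (forall f g, f =1 g -> F f = F g) ->
  (\sum_(j : {ffun 'I_n -> 'I_(a * b)}) F (fun x => j x) =
   \sum_(j1 : {ffun 'I_n -> 'I_a}) \sum_(j2 : {ffun 'I_n -> 'I_b})
      F (fun x => b * j1 x + j2 x))%N.
Proof.
move=> Fext; rewrite pair_big /=.
have lt (u : 'I_a) (v : 'I_b) : (b * u + v < a * b)%N.
  by have := ltn_ord u; have := ltn_ord v; nia.
pose f (q : {ffun 'I_n -> 'I_a} * {ffun 'I_n -> 'I_b}) : {ffun 'I_n -> 'I_(a * b)} :=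
  [ffun x => Ordinal (lt (q.1 x) (q.2 x))].
have finj : injective f.
  move=> [q1 q2] [r1 r2] /ffunP e.
  suff h x : q1 x = r1 x /\ q2 x = r2 x.
    by congr pair; apply/ffunP => x; case: (h x).
  have := e x; rewrite !ffunE => /(congr1 val) /= ex.
  have := ltn_ord (q2 x); have := ltn_ord (r2 x) => h1 h2.
  have := congr1 (fun m => m %/ b)%N ex; have := congr1 (fun m => m %% b)%N ex.
  have b0 : (0 < b)%N by lia.
  rewrite !(mulnC b) !modnMDl !divnMDl // !modn_small // !divn_small // !addn0 => e2 e1.
  by split; apply: val_inj.
have fbij : bijective f.
  apply: inj_card_bij finj _.
  by rewrite card_prod !card_ffun !card_ord expnMn.
rewrite (reindex f) /=; last exact: onW_bij.
by apply: eq_bigr => q _; apply: Fext => x; rewrite ffunE.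
Qed.

Lemma integral_itv_cst (R : realType) (a b c : R) (f : R -> \bar R) : a <= b ->
  (forall x, a <= x < b -> f x = c%:E) -> (forall x, ~~ (a <= x < b) -> f x = 0%E) ->
  (\int[@lebesgue_measure R]_x f x)%E = ((b - a) * c)%:E.
Proof.
move=> ab f1 f0.
have -> : f = (cst c%:E) \_ `[a, b[.
  apply/funext => x; rewrite patchE mem_setE in_itv /=.
  by case: ifPn => [/f1|/f0].
rewrite -integral_mkcond integral_cst; last exact: measurable_itv.
rewrite [X in (_ * X)%E](_ : _ = lebesgue_measure (`[a, b[%classic : set R)) //.
rewrite lebesgue_measure_itv /= lte_fin.
case: ltP => h; first by rewrite -EFinB -EFinM mulrC.
have -> : b = a by lra.
by rewrite mule0 subrr mul0r.
Qed.

Lemma lebesgue_row_set0 (R : realType) n : lebesgue_row (set0 : set 'rV[R]_n) = 0%E.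
Proof.
elim: n => [|n IH] /=; first by rewrite indicE in_set0.
rewrite (@integral_itv_cst _ 0 0 0) ?mulr0 // => x _;
  by rewrite -[RHS]IH; congr lebesgue_row; apply/seteqP; split.
Qed.

Lemma lebesgue_row_box (R : realType) n (a b : 'I_n -> R) : (forall i, a i <= b i) ->
  lebesgue_row [set v : 'rV[R]_n | forall i, a i <= v 0 i < b i]
    = (\prod_i (b i - a i))%:E.
Proof.
elim: n a b => [|n IH] a b ab /=.
  rewrite big_ord0 indicE mem_set //; by case.
have row_tail (x : R) (v : 'rV[R]_n) i : (row_mx (x%:M : 'rV[R]_1) v) 0 (lift ord0 i) = v 0 i.
  have -> : lift ord0 i = rshift 1 i :> 'I_(1 + n) by exact: val_inj.
  exact: row_mxEr.
have row_head (x : R) (v : 'rV[R]_n) : (row_mx (x%:M : 'rV[R]_1) v) 0 ord0 = x.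
  have -> : ord0 = lshift n (ord0 : 'I_1) :> 'I_(1 + n) by exact: val_inj.
  by rewrite row_mxEl mxE eqxx mulr1n.
rewrite big_ord_recl.
rewrite (@integral_itv_cst _ (a ord0) (b ord0) (\prod_(i < n) (b (lift ord0 i) - a (lift ord0 i)))) //.
  move=> x hx; rewrite -IH //; congr lebesgue_row; apply/seteqP; split=> v /= h i.
    have := h (lift ord0 i).
    by rewrite row_tail.
  case: (unliftP ord0 i) => [i'|] ->; first by rewrite row_tail; exact: (h i').
  by rewrite row_head.
move=> x hx; rewrite -[RHS](lebesgue_row_set0 _ n); congr lebesgue_row; apply/seteqP; split=> v //= h.
by have := h ord0; rewrite row_head (negbTE hx).
Qed.

(** * The parabolic lattice *)

Section ParabolicLattice.
Variables (R : realType) (n d : nat) (p : R).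
Hypothesis s9 : 9 <= two_dp p d.
Local Notation s := (two_dp p d).
Local Notation kd := (tdiv p d).
Implicit Types P Q S : prect R n.

(** A child has side L / 2^d, hence L'^p = L^p / s, and temporal length (1 - g) L^p / k; so its
    parameter g' satisfies 1 - g' = (1 - g) s / k. This is the same for all children, and truncation
    and temporal count depend only on the level. *)
Definition gamma1 (g : R) : R := 1 - (1 - g) * s / (kd g)%:R.
Definition gamma_at (i : nat) (g : R) : R := iter i gamma1 g.
Definition tcount (i : nat) (g : R) : nat := \prod_(a < i) kd (gamma_at a g).
Definition kmax : nat := `|Num.ceil s|%N.

Lemma kmaxE : (kmax%:R : R) = (Num.ceil s)%:~R.
Proof.
have h9 := s9.
rewrite /kmax natr_absz ger0_norm // -(ler_int R) mulr0z.
by apply: (le_trans _ (ceil_ge _)); lra.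
Qed.

Lemma kmax_ge : s <= kmax%:R.
Proof. by rewrite kmaxE ceil_ge. Qed.

Lemma kmax_lt : kmax%:R < s + 1.
Proof.
have h9 := s9.
by rewrite kmaxE; move: (ceil_itv s) => /andP[]; rewrite intrB; lra.
Qed.

Lemma tdiv_or g : (g <= 1 - (s + 1) / 2 `^ (d%:R * p + 1) /\ kd g = kmax) \/
  (1 - (s + 1) / 2 `^ (d%:R * p + 1) < g /\ (s - 1 < (kd g)%:R <= s)).
Proof.
have h9 := s9.
rewrite /tdiv; case: ifPn => h; first by left.
right; split; first by rewrite ltNge.
have e : (`|Num.floor s|%N%:R : R) = (Num.floor s)%:~R.
  by rewrite natr_absz ger0_norm // floor_ge0; lra.
rewrite e; move: (floor_itv s) => /andP[]; rewrite intrD; lra.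
Qed.

Lemma pow2dp1 : (2 : R) `^ (d%:R * p + 1) = s * 2.
Proof. by rewrite powRD ?powRr1 //; apply/implyP => _; rewrite pnatr_eq0. Qed.

Lemma tdiv_ge9 g : (9 <= kd g)%N.
Proof.
have h9 := s9.
case: (tdiv_or g) => [[_ ->]|[_ /andP[h _]]].
  by rewrite -(ler_nat R); apply: le_trans kmax_ge.
have : (8%:R : R) < (kd g)%:R by lra.
by rewrite ltr_nat.
Qed.

Lemma tdiv_le g : (kd g <= kmax)%N.
Proof.
case: (tdiv_or g) => [[_ ->]//|[_ /andP[_ h]]].
by rewrite -(ler_nat R); apply: (le_trans h kmax_ge).
Qed.

Lemma tdiv_gt0 g : (0 < kd g)%N.
Proof. exact: leq_trans (tdiv_ge9 g). Qed.

(** The threshold is 1/2 - 1/(2s), so that g lies below it when (1 - g) s >= (s + 1)/2. There the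
    ceiling satisfies s <= k < s + 1; above it the floor satisfies (1 - g) s < (s + 1)/2 <= s - 1 <
    k <= s. Both cases put (1 - g) s / k in [1/2, 1]. *)
Lemma gamma1_range g : 0 <= g <= 2^-1 -> 0 <= gamma1 g <= 2^-1.
Proof.
have h9 := s9.
move=> /andP[g0 g2]; rewrite /gamma1.
have k0 : (0 : R) < (kd g)%:R by rewrite ltr0n tdiv_gt0.
have k9 : (9%:R : R) <= (kd g)%:R by rewrite ler_nat tdiv_ge9.
suff [h1 h2] : (1 - g) * s / (kd g)%:R <= 1 /\ 2^-1 <= (1 - g) * s / (kd g)%:R by lra.
rewrite ler_pdivrMr // ler_pdivlMr // mul1r.
have s0 : 0 < s by lra.
have e : (s + 1) / 2 `^ (d%:R * p + 1) = 2^-1 + (2 * s)^-1.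
  by rewrite pow2dp1; field; lra.
have si : s * (2 * s)^-1 = 2^-1 by field; lra.
case: (tdiv_or g) => [[h ->]|[h /andP[h1 h2]]]; move: h; rewrite e => h.
- have := kmax_ge; have := kmax_lt => u v; split; first by nra.
  have : s * (2^-1 + (2 * s)^-1) <= s * (1 - g) by apply: ler_wpM2l; lra.
  rewrite (mulrDr s 2^-1) si; lra.
- split; last by nra.
  have : s * (1 - g) <= s * (2^-1 + (2 * s)^-1) by apply: ler_wpM2l; lra.
  rewrite (mulrDr s 2^-1) si; lra.
Qed.

Lemma gamma_range i g : 0 <= g <= 2^-1 -> 0 <= gamma_at i g <= 2^-1.
Proof. by move=> h; elim: i => // i IH; rewrite /gamma_at iterS gamma1_range. Qed.

Lemma gamma_atD i j g : gamma_at (i + j) g = gamma_at j (gamma_at i g).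
Proof. by rewrite /gamma_at addnC iterD. Qed.

Lemma tcount0 g : tcount 0 g = 1%N. Proof. by rewrite /tcount big_ord0. Qed.
Lemma tcount1 g : tcount 1 g = kd g. Proof. by rewrite /tcount big_ord1. Qed.

Lemma tcountD i j g : tcount (i + j) g = (tcount i g * tcount j (gamma_at i g))%N.
Proof.
elim: j => [|j IH]; first by rewrite addn0 tcount0 muln1.
by rewrite addnS /tcount !big_ord_recr /= -!/(tcount _ _) IH -mulnA gamma_atD.
Qed.

Lemma tcount_ge i g : (9 ^ i <= tcount i g)%N.
Proof.
elim: i g => [|i IH] g; first by rewrite tcount0.
by rewrite -(addn1 i) tcountD tcount1 expnD leq_mul // tdiv_ge9.
Qed.

Lemma tcount_le i g : (tcount i g <= kmax ^ i)%N.
Proof.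
elim: i g => [|i IH] g; first by rewrite tcount0.
by rewrite -(addn1 i) tcountD tcount1 expnD leq_mul // tdiv_le.
Qed.

Lemma tcount_gt0 i g : (0 < tcount i g)%N.
Proof. by apply: leq_trans (tcount_ge i g); rewrite expn_gt0. Qed.

Lemma tcount_neq0 i g : (tcount i g)%:R != 0 :> R.
Proof. by rewrite pnatr_eq0 -lt0n tcount_gt0. Qed.

Lemma subr_gamma_at i g : 1 - gamma_at i g = (1 - g) * s ^+ i / (tcount i g)%:R.
Proof.
elim: i g => [|i IH] g; first by rewrite tcount0 /=; field.
rewrite -add1n gamma_atD IH tcountD tcount1 /= /gamma1 natrM exprS.
have := tcount_neq0 i (gamma_at 1 g); rewrite /= /gamma1.
have : (kd g)%:R != 0 :> R by rewrite pnatr_eq0 -lt0n tdiv_gt0.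
move=> h1 h2; field; by rewrite h1 h2.
Qed.

(** Rounding does not accumulate over the levels: by [subr_gamma_at], s^i / [tcount i g] is a
    quotient of two numbers in [1/2, 1]. *)
Lemma tcount_lower i g : 0 <= g <= 2^-1 -> s ^+ i <= 2 * (tcount i g)%:R.
Proof.
have h9 := s9.
move=> g02; have /andP[h1 h2] := gamma_range i g02.
have := subr_gamma_at i g => /(congr1 (fun x => x * (tcount i g)%:R)).
rewrite divfK ?tcount_neq0 // => e.
have t0 : (0 : R) < (tcount i g)%:R by rewrite ltr0n tcount_gt0.
have si0 : 0 < s ^+ i by rewrite exprn_gt0 //; lra.
case/andP: g02 => g0 g2; nra.
Qed.

Lemma powR_side (L : R) i : 0 <= L -> (L / 2 ^+ (d * i)) `^ p = L `^ p / s ^+ i.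
Proof.
move=> L0; rewrite powRM // ?invr_ge0 ?exprn_ge0 //; congr (_ * _).
rewrite -powR_inv1 ?exprn_ge0 // -!powR_mulrn ?powR_ge0 //.
rewrite -!powRrM -powR_inv1 ?powR_ge0 // -!powRrM; congr (_ `^ _).
by rewrite natrM; ring.
Qed.

(* The indices are not restricted to P: all translates of the dyadic cells of P by
   their own side lengths are included, e.g. [cell P 0 (fun=> 0) z] is P^z. *)
Definition cell P (i : nat) (j : 'I_n -> int) (tau : int) : prect R n :=
  PRect (\row_a (pr_x P 0 a - pr_L P / 2
                 + ((j a)%:~R + 2^-1) * (pr_L P / 2 ^+ (d * i))))
        (pr_t P - pr_L P `^ p + tau%:~R * (l_t p P / (tcount i (pr_gamma P))%:R)
          + (pr_L P / 2 ^+ (d * i)) `^ p)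
        (pr_L P / 2 ^+ (d * i)) (gamma_at i (pr_gamma P)).

Lemma is_prect_cell P i j tau : is_prect P -> is_prect (cell P i j tau).
Proof.
move=> [L0 g0]; split; last exact: gamma_range.
by rewrite /= divr_gt0 ?exprn_gt0.
Qed.

Lemma l_t_cell P i j tau : is_prect P ->
  l_t p (cell P i j tau) = l_t p P / (tcount i (pr_gamma P))%:R.
Proof.
have h9 := s9.
move=> [L0 g0]; rewrite /l_t /= subr_gamma_at powR_side ?ltW //.
have h := tcount_neq0 i (pr_gamma P).
have si0 : s ^+ i != 0 by rewrite expf_neq0 //; lra.
by field; rewrite h si0.
Qed.

Lemma eq_cell P i j j' tau tau' : j =1 j' -> tau = tau' ->
  cell P i j tau = cell P i j' tau'.
Proof. by move=> /funext -> ->. Qed.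

(** Indices compose like digits in a mixed radix, also outside the range of the parent; dyadic
    geometry thus becomes integer arithmetic. *)
Lemma cell_cell P i j tau i' j' tau' : is_prect P ->
  cell (cell P i j tau) i' j' tau' =
  cell P (i + i') (fun a => (2 ^ (d * i'))%N%:Z * j a + j' a)
       ((tcount i' (gamma_at i (pr_gamma P)))%:Z * tau + tau').
Proof.
move=> hP; have [L0 g0] := hP.
have L' : pr_L P / 2 ^+ (d * i) / 2 ^+ (d * i') = pr_L P / 2 ^+ (d * (i + i')).
  by rewrite mulnDr exprD; field; rewrite !expf_neq0.
rewrite {1}/cell /=; congr PRect.
- apply/rowP => a; rewrite !mxE rmorphD rmorphM /= -L'.
  rewrite (_ : (2 ^ (d * i'))%N%:~R = 2 ^+ (d * i') :> R); last first.
    by rewrite -natrX -pmulrn.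
  by field; rewrite !expf_neq0.
- rewrite l_t_cell // L' rmorphD rmorphM /= tcountD natrM -pmulrn.
  have h := tcount_neq0 i (pr_gamma P).
  have h' := tcount_neq0 i' (gamma_at i (pr_gamma P)).
  by field; rewrite h h'.
- by [].
- by rewrite gamma_atD.
Qed.

Lemma cell0 P : cell P 0 (fun=> 0) 0 = P.
Proof.
case: P => x t L g; rewrite /cell /= muln0 expr0 divr1; congr PRect.
- by apply/rowP => a; rewrite !mxE; field.
- by ring.
Qed.

Definition in_range P i (j : 'I_n -> int) (tau : int) : Prop :=
  (forall a, 0 <= j a < (2 ^ (d * i))%N%:Z) /\ 0 <= tau < (tcount i (pr_gamma P))%:Z.

Lemma prect_child_cell P (j : 'I_n -> 'I_(2 ^ d)) (m : 'I_(kd (pr_gamma P))) :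
  is_prect P ->
  prect_child j m = cell P 1 (fun a => (j a : nat)%:Z) (m : nat)%:Z.
Proof.
have h9 := s9.
move=> [L0 _]; rewrite /prect_child /cell muln1 tcount1 -!pmulrn; congr PRect.
have := powR_side 1 (ltW L0); rewrite muln1 expr1 => ->.
rewrite /gamma_at /= /gamma1 /l_t.
have : (kd (pr_gamma P))%:R != 0 :> R by rewrite pnatr_eq0 -lt0n tdiv_gt0.
have Lp : pr_L P `^ p != 0 by rewrite gt_eqF ?powR_gt0.
have s0 : s != 0 by lra.
by move=> h; field; rewrite h s0 Lp.
Qed.

Lemma dyadic_levelP P i Q : is_prect P ->
  dyadic_level p d i P Q <-> exists j tau, in_range P i j tau /\ Q = cell P i j tau.
Proof.
move=> hP; elim: i Q => [|i IH] Q /=.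
  split=> [->|[j [tau [[hj ht] ->]]]].
    exists (fun=> 0), 0; rewrite cell0; split=> //; split=> [a|]; by rewrite ?muln0 ?tcount0.
  rewrite -[RHS]cell0; apply: eq_cell.
    by move=> a; have := hj a; rewrite muln0 expn0; lia.
  by move: ht; rewrite tcount0; lia.
split=> [[Q0 /IH[j [tau [[hj ht] ->]]]]|[j [tau [[hj ht] ->]]]].
  rewrite /dyadic1 /= => -[j' [m ->]].
  rewrite prect_child_cell; last exact: is_prect_cell.
  rewrite cell_cell // addn1 muln1; do 2 eexists; split; last by [].
  split=> [a|].
    have := hj a; have := ltn_ord (j' a); rewrite mulnS expnD; nia.
  rewrite tcount1 -(addn1 i) tcountD tcount1.
  by have := ltn_ord m; rewrite /=; nia.
(* Parent and position inside the parent are quotient and remainder of the indices. *)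
have dd : (2 ^ d)%N%:Z != 0 :> int by rewrite eqz_nat -lt0n expn_gt0.
have dk : (kd (gamma_at i (pr_gamma P)))%:Z != 0 :> int by rewrite eqz_nat -lt0n tdiv_gt0.
have jl a : (`|(j a %% (2 ^ d)%N%:Z)%Z| < 2 ^ d)%N.
  by have := modz_ge0 (j a) dd; have := ltz_mod (j a) dd; lia.
have ml : (`|(tau %% (kd (gamma_at i (pr_gamma P)))%:Z)%Z| < kd (gamma_at i (pr_gamma P)))%N.
  by have := modz_ge0 tau dk; have := ltz_mod tau dk; lia.
exists (cell P i (fun a => (j a %/ (2 ^ d)%N%:Z)%Z) (tau %/ (kd (gamma_at i (pr_gamma P)))%:Z)%Z).
  apply/IH; do 2 eexists; split; last by []; split=> [a|].
    have := hj a; rewrite mulnS expnD; have := divz_eq (j a) (2 ^ d)%N%:Z.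
    have := modz_ge0 (j a) dd; have := ltz_mod (j a) dd; nia.
  move: ht; rewrite -(addn1 i) tcountD tcount1; have := divz_eq tau (kd (gamma_at i (pr_gamma P)))%:Z.
  have := modz_ge0 tau dk; have := ltz_mod tau dk; nia.
exists (fun a => Ordinal (jl a)), (Ordinal ml).
rewrite prect_child_cell; last exact: is_prect_cell.
rewrite cell_cell // addn1 muln1 tcount1 /=; apply: eq_cell => [a|] /=.
  have := modz_ge0 (j a) dd; have := divz_eq (j a) (2 ^ d)%N%:Z; lia.
have := modz_ge0 tau dk; have := divz_eq tau (kd (gamma_at i (pr_gamma P)))%:Z; lia.
Qed.

Lemma l_t_gt0 P : is_prect P -> 0 < l_t p P.
Proof.
move=> [L0 /andP[g0 g2]]; rewrite /l_t mulr_gt0 ?powR_gt0 //; lra.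
Qed.

(** In this form the indices are integer parts of rescaled coordinates, from which disjointness
    ([cell_inj]) and inclusion ([cell_sub]) are read off. *)
Lemma mem_cell P i j tau z : is_prect P ->
  prect_set p (cell P i j tau) z <->
  (forall a, (j a)%:~R <= (z.1 0 a - (pr_x P 0 a - pr_L P / 2)) / (pr_L P / 2 ^+ (d * i))
             < (j a + 1)%:~R) /\
  tau%:~R <= (z.2 - (pr_t P - pr_L P `^ p)) / (l_t p P / (tcount i (pr_gamma P))%:R)
          < (tau + 1)%:~R.
Proof.
move=> hP; have [L0 g0] := hP.
have Li : 0 < pr_L P / 2 ^+ (d * i) by rewrite divr_gt0 ?exprn_gt0.
have hi : 0 < l_t p P / (tcount i (pr_gamma P))%:R.
  by rewrite divr_gt0 ?l_t_gt0 // ltr0n tcount_gt0.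
have := l_t_cell i j tau hP; rewrite /l_t /= -/(l_t p P) => e.
rewrite /prect_set /=.
set Lp := (_ / 2 ^+ _) `^ p in e *.
set hh := l_t p P / _ in e hi *.
have e' : gamma_at i (pr_gamma P) * Lp = Lp - hh by rewrite -e; ring.
rewrite e'; split=> -[h1 h2]; split.
- move=> a; move: (h1 a); rewrite !mxE ler_pdivlMr // ltr_pdivrMr // intrD.
  lra.
- move: h2; rewrite ler_pdivlMr // ltr_pdivrMr // intrD; lra.
- move=> a; move: (h1 a); rewrite !mxE ler_pdivlMr // ltr_pdivrMr // intrD; lra.
- move: h2; rewrite ler_pdivlMr // ltr_pdivrMr // intrD; lra.
Qed.

Lemma cell_inj P i j tau j' tau' z : is_prect P ->
  prect_set p (cell P i j tau) z -> prect_set p (cell P i j' tau') z ->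
  j =1 j' /\ tau = tau'.
Proof.
move=> hP /mem_cell-/(_ hP)[h1 h2] /mem_cell-/(_ hP)[h1' h2'].
have key (u v : int) (x : R) : u%:~R <= x < (u + 1)%:~R -> v%:~R <= x < (v + 1)%:~R -> u = v.
  move=> /andP[a b] /andP[a' b'].
  have := le_lt_trans a b'; have := le_lt_trans a' b; rewrite !ltr_int; lia.
split=> [a|]; [exact: key (h1 a) (h1' a)|exact: key h2 h2'].
Qed.

Lemma cell_sub P i j tau : is_prect P -> in_range P i j tau ->
  prect_set p (cell P i j tau) `<=` prect_set p P.
Proof.
move=> hP [hj ht] z /mem_cell-/(_ hP)[h1 h2]; have [L0 g0] := hP.
rewrite -[P]cell0; apply/mem_cell => //; split.
- move=> a; move: (h1 a) (hj a) => /andP[u v] /andP[u' v'].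
  rewrite muln0 expr0 divr1 /= add0r.
  have e : (2 ^ (d * i))%:R = 2 ^+ (d * i) :> R by rewrite natrX.
  have := le_trans _ u => /(_ 0); rewrite ler0z => /(_ u').
  have : (j a + 1)%:~R <= (2 ^ (d * i))%:R :> R by rewrite pmulrn ler_int; lia.
  rewrite e => h3; have := lt_le_trans v h3.
  rewrite ltr_pdivrMr ?divr_gt0 ?exprn_gt0 // ler_pdivlMr ?divr_gt0 ?exprn_gt0 //.
  rewrite mulrCA divff ?mulr1 ?expf_neq0 // ltr_pdivrMr // ler_pdivlMr //; lra.
- move: h2 ht => /andP[u v] /andP[u' v']; rewrite tcount0 divr1 add0r.
  have t0 : (0 : R) < (tcount i (pr_gamma P))%:R by rewrite ltr0n tcount_gt0.
  have l0 := l_t_gt0 hP.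
  have := le_trans _ u => /(_ 0); rewrite ler0z => /(_ u').
  have : (tau + 1)%:~R <= (tcount i (pr_gamma P))%:R :> R by rewrite pmulrn ler_int; lia.
  move=> h3; have := lt_le_trans v h3.
  rewrite ltr_pdivrMr ?divr_gt0 // ler_pdivlMr ?divr_gt0 //.
  rewrite mulrCA divff ?mulr1 ?tcount_neq0 // ltr_pdivrMr // ler_pdivlMr //; lra.
Qed.

Lemma prect_set_neq0 P : is_prect P -> prect_set p P !=set0.
Proof.
move=> hP; have [L0 g0] := hP.
exists (\row_a (pr_x P 0 a - pr_L P / 2), pr_t P - pr_L P `^ p).
rewrite -[X in prect_set p X](cell0 P); apply/mem_cell => //=; split.
  by move=> a; rewrite mxE subrr mul0r mulr0z lexx add0r ltr0z.
by rewrite subrr mul0r mulr0z lexx add0r ltr0z.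
Qed.

Lemma in_range_cell P i j tau i' j' tau' :
  in_range P i j tau -> in_range (cell P i j tau) i' j' tau' ->
  in_range P (i + i') (fun a => (2 ^ (d * i'))%N%:Z * j a + j' a)
       ((tcount i' (gamma_at i (pr_gamma P)))%:Z * tau + tau').
Proof.
move=> [hj ht] [hj' ht']; split=> [a|].
  by have := hj a; have := hj' a; rewrite mulnDr expnD; nia.
by rewrite tcountD; move: ht ht' => /=; nia.
Qed.

Lemma in_range_split P i i' j tau : in_range P (i + i') j tau ->
  exists j1 tau1 j2 tau2, [/\ in_range P i j1 tau1, in_range (cell P i j1 tau1) i' j2 tau2,
    j =1 (fun a => (2 ^ (d * i'))%N%:Z * j1 a + j2 a) &
    tau = (tcount i' (gamma_at i (pr_gamma P)))%:Z * tau1 + tau2].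
Proof.
move=> [hj ht].
set D := (2 ^ (d * i'))%N%:Z; set K := (tcount i' (gamma_at i (pr_gamma P)))%:Z.
have D0 : D != 0 by rewrite eqz_nat -lt0n expn_gt0.
have K0 : K != 0 by rewrite eqz_nat -lt0n tcount_gt0.
exists (fun a => (j a %/ D)%Z), (tau %/ K)%Z, (fun a => (j a %% D)%Z), (tau %% K)%Z.
split.
- split=> [a|].
    have := hj a; rewrite mulnDr expnD; have := divz_eq (j a) D.
    by have := modz_ge0 (j a) D0; have := ltz_mod (j a) D0; rewrite /D; nia.
  move: ht; rewrite tcountD; have := divz_eq tau K.
  by have := modz_ge0 tau K0; have := ltz_mod tau K0; rewrite /K; nia.
- split=> [a|].
    by have := modz_ge0 (j a) D0; have := ltz_mod (j a) D0; rewrite /D; lia.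
  by have := modz_ge0 tau K0; have := ltz_mod tau K0; rewrite /K /=; lia.
- by move=> a; rewrite {1}(divz_eq (j a) D) mulrC.
- by rewrite {1}(divz_eq tau K) mulrC.
Qed.

Lemma in_range0 P i : in_range P i (fun=> 0) 0.
Proof. by split=> [a|]; rewrite lexx /= ltz_nat ?expn_gt0 ?tcount_gt0. Qed.

(** The translate P^z, written as a cell of level 0 so that [cell_cell] applies; [prect_shiftE]
    identifies it with the shift in the definition of weak porosity. *)
Definition tshift P (z : int) := cell P 0 (fun=> 0) z.

Lemma is_prect_tshift P z : is_prect P -> is_prect (tshift P z).
Proof. exact: is_prect_cell. Qed.

Lemma cell_tshift P z i j tau : is_prect P ->
  cell (tshift P z) i j tau = cell P i j ((tcount i (pr_gamma P))%:Z * z + tau).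
Proof.
move=> hP; rewrite /tshift cell_cell // add0n; apply: eq_cell => // a.
by rewrite mulr0 add0r.
Qed.

Lemma tshift_cell P z i j tau : is_prect P ->
  tshift (cell P i j tau) z = cell P i j (tau + z).
Proof.
move=> hP; rewrite /tshift cell_cell // addn0; apply: eq_cell => [a|].
  by rewrite muln0 expn0; lia.
by rewrite tcount0; lia.
Qed.

Lemma tshift_tshift P y z : is_prect P -> tshift (tshift P y) z = tshift P (y + z).
Proof. by move=> hP; rewrite {2}/tshift tshift_cell. Qed.

Lemma tshift0 P : tshift P 0 = P. Proof. exact: cell0. Qed.

Lemma prect_shiftE P (z : int) : prect_shift p z%:~R P = tshift P z.
Proof.
rewrite /prect_shift /tshift /cell muln0 expr0 divr1 tcount0; congr PRect.
- by apply/rowP => a; rewrite !mxE; field.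
- by field.
Qed.

(** * Counting cells, and their volumes *)

Definition ncells i (g : R) : nat := (2 ^ (d * i)) ^ n * tcount i g.

Lemma ncellsD i j g : ncells (i + j) g = (ncells i g * ncells j (gamma_at i g))%N.
Proof. by rewrite /ncells tcountD mulnDr expnD expnMn; lia. Qed.

Lemma ncells_gt0 i g : (0 < ncells i g)%N.
Proof. by rewrite muln_gt0 !expn_gt0 tcount_gt0. Qed.

Lemma ncells0 g : ncells 0 g = 1%N.
Proof. by rewrite /ncells muln0 expn0 exp1n tcount0. Qed.

Lemma ncells_le i g : (ncells i g <= ((2 ^ d) ^ n * kmax) ^ i)%N.
Proof.
rewrite /ncells expnMn; apply: leq_mul; last exact: tcount_le.
by rewrite -!expnM -mulnA (mulnC i).
Qed.

Lemma ncells_ge i g : (2 ^ i <= ncells i g)%N.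
Proof.
rewrite -[leqLHS]mul1n leq_mul //; first by rewrite !expn_gt0.
by apply: leq_trans (tcount_ge i g); case: (i) => // m; rewrite leq_exp2r.
Qed.

Definition csum P i (F : prect R n -> nat) : nat :=
  (\sum_(j : {ffun 'I_n -> 'I_(2 ^ (d * i))}) \sum_(t < tcount i (pr_gamma P))
     F (cell P i (fun a => (j a : nat)%:Z) (t : nat)%:Z))%N.

Lemma in_range_ord P i (j : {ffun 'I_n -> 'I_(2 ^ (d * i))}) (t : 'I_(tcount i (pr_gamma P))) :
  in_range P i (fun a => (j a : nat)%:Z) (t : nat)%:Z.
Proof. by split=> [a|]; [have := ltn_ord (j a)|have := ltn_ord t]; lia. Qed.

Lemma in_range_ordP P i j tau : in_range P i j tau -> exists (j' : {ffun 'I_n -> 'I_(2 ^ (d * i))})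
    (t' : 'I_(tcount i (pr_gamma P))), (forall a, j a = (j' a : nat)%:Z) /\ tau = (t' : nat)%:Z.
Proof.
move=> [hj ht].
have lj a : (`|j a| < 2 ^ (d * i))%N by have := hj a; lia.
have lt : (`|tau| < tcount i (pr_gamma P))%N by lia.
exists [ffun a => Ordinal (lj a)], (Ordinal lt); split=> [a|] /=; last by lia.
by rewrite ffunE /=; have := hj a; lia.
Qed.

Lemma eq_csum P i F G : (forall j tau, in_range P i j tau -> F (cell P i j tau) = G (cell P i j tau)) ->
  csum P i F = csum P i G.
Proof.
by move=> h; apply: eq_bigr => j _; apply: eq_bigr => t _; apply: h; exact: in_range_ord.
Qed.

Lemma leq_csum P i F G : (forall j tau, in_range P i j tau -> (F (cell P i j tau) <= G (cell P i j tau))%N) ->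
  (csum P i F <= csum P i G)%N.
Proof.
by move=> h; apply: leq_sum => j _; apply: leq_sum => t _; apply: h; exact: in_range_ord.
Qed.

Lemma csum_const P i c : csum P i (fun=> c) = (ncells i (pr_gamma P) * c)%N.
Proof. by rewrite /csum !sum_nat_const !card_ord card_ffun !card_ord mulnA. Qed.

Lemma csum_ge P i j tau F : in_range P i j tau -> (F (cell P i j tau) <= csum P i F)%N.
Proof.
move=> /in_range_ordP[j' [t' [h1 h2]]]; rewrite (eq_cell P i h1 h2).
by rewrite /csum (bigD1 j') //= (bigD1 t') //= -addnA leq_addr.
Qed.

Lemma csum0 P F : csum P 0 F = F P.
Proof.
have h : 1%N = ncells 0 (pr_gamma P) by rewrite ncells0.
rewrite (@eq_csum P 0 F (fun=> F P)) ?csum_const -?h ?mul1n // => j tau [hj ht].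
congr F; rewrite -[RHS]cell0; apply: eq_cell => [a|].
  by have := hj a; rewrite muln0 expn0; lia.
by move: ht; rewrite tcount0; lia.
Qed.

Lemma csumD P i i' F : is_prect P ->
  csum P (i + i') F = csum P i (fun Q => csum Q i' F).
Proof.
move=> hP; rewrite /csum.
have -> : (2 ^ (d * (i + i')) = 2 ^ (d * i) * 2 ^ (d * i'))%N by rewrite mulnDr expnD.
rewrite tcountD /=.
pose G (j : 'I_n -> nat) := (\sum_(t < tcount i (pr_gamma P) * tcount i' (gamma_at i (pr_gamma P)))
   F (cell P (i + i') (fun a => (j a)%:Z) (t : nat)%:Z))%N.
have Gext f g : f =1 g -> G f = G g.
  by move=> fg; apply: eq_bigr => t _; congr F; apply: eq_cell => // a; rewrite fg.
transitivity (\sum_(j : {ffun 'I_n -> 'I_(2 ^ (d * i) * 2 ^ (d * i'))}) G (fun x => j x))%N.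
  by [].
rewrite (sum_ffun_mul _ _ Gext).
apply: eq_bigr => j1 _; rewrite [RHS]exchange_big /=.
apply: eq_bigr => j2 _; rewrite /G.
rewrite (sum_ord_mul _ _ (fun t => F (cell P (i + i') _ t%:Z))).
apply: eq_bigr => t1 _; apply: eq_bigr => t2 _.
by congr F; rewrite cell_cell.
Qed.

Lemma vol_prect P : is_prect P ->
  vol (prect_set p P) = (pr_L P ^+ n * l_t p P)%:E.
Proof.
move=> hP; have l0 := l_t_gt0 hP; have [L0 g0] := hP.
rewrite /vol (@integral_itv_cst _ (pr_t P - pr_L P `^ p)
  (pr_t P - pr_gamma P * pr_L P `^ p) (pr_L P ^+ n)).
- by rewrite mulrC; congr (_ * _)%:E; rewrite /l_t; ring.
- by move: l0; rewrite /l_t; lra.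
- move=> t ht.
  transitivity (lebesgue_row [set v : 'rV[R]_n | forall i,
      pr_x P 0 i - pr_L P / 2 <= v 0 i < pr_x P 0 i + pr_L P / 2]).
    by congr lebesgue_row; apply/seteqP; split=> v /=; [case|].
  rewrite (@lebesgue_row_box _ _ (fun i => pr_x P 0 i - pr_L P / 2)
            (fun i => pr_x P 0 i + pr_L P / 2)); last by move=> i; lra.
  congr (_%:E); rewrite (eq_bigr (fun=> pr_L P)) ?prodr_const ?card_ord // => i _.
  by field.
- move=> t ht; rewrite -[RHS](lebesgue_row_set0 _ n); congr lebesgue_row; apply/seteqP; split=> v //= [_].
  by rewrite (negbTE ht).
Qed.

Lemma vol_cell P i j tau : is_prect P ->
  vol (prect_set p (cell P i j tau)) =
  (pr_L P ^+ n * l_t p P / (ncells i (pr_gamma P))%:R)%:E.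
Proof.
move=> hP; rewrite vol_prect; last exact: is_prect_cell.
rewrite l_t_cell //= /ncells natrM !natrX; congr (_%:E).
rewrite expr_div_n -natrX; have h := tcount_neq0 i (pr_gamma P).
by field; rewrite h !expf_neq0 // pnatr_eq0 -lt0n expn_gt0.
Qed.

(** Translation by whole steps of the level-r grid of S. The translate has the same grid, so its
    overlap with S can be counted in level-r cells. *)
Definition lattice_shift r S (zx : 'I_n -> int) (zt : int) : prect R n :=
  PRect (\row_a (pr_x S 0 a + (zx a)%:~R * (pr_L S / 2 ^+ (d * r))))
        (pr_t S + zt%:~R * (l_t p S / (tcount r (pr_gamma S))%:R)) (pr_L S) (pr_gamma S).

Lemma eq_lattice_shift r S zx zt zx' zt' : zx =1 zx' -> zt = zt' ->
  lattice_shift r S zx zt = lattice_shift r S zx' zt'.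
Proof. by move=> /funext -> ->. Qed.

Lemma cell_lattice_shift r S zx zt j tau :
  cell (lattice_shift r S zx zt) r j tau = cell S r (fun a => j a + zx a) (tau + zt).
Proof.
rewrite /cell /lattice_shift /= /l_t /=; congr PRect; first by apply/rowP => a; rewrite !mxE intrD /=; ring.
by rewrite intrD /=; ring.
Qed.

Lemma lattice_shift0 r S : lattice_shift r S (fun=> 0) 0 = S.
Proof.
case: S => x t L g; rewrite /lattice_shift /=; congr PRect; last by rewrite mul0r addr0.
by apply/rowP => a; rewrite !mxE mul0r addr0.
Qed.

Lemma lattice_shiftD r S zx zt zx' zt' :
  lattice_shift r (lattice_shift r S zx zt) zx' zt' = lattice_shift r S (fun a => zx a + zx' a) (zt + zt').
Proof.
rewrite /lattice_shift /= /l_t /=; congr PRect; first by apply/rowP => a; rewrite !mxE intrD /=; ring.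
by rewrite intrD /=; ring.
Qed.

Lemma lattice_shift_tshift r S zx zt w :
  lattice_shift r (tshift S w) zx zt = lattice_shift r S zx (zt + w * (tcount r (pr_gamma S))%:Z).
Proof.
rewrite -prect_shiftE /lattice_shift /prect_shift /= /l_t /=; congr PRect.
rewrite rmorphD rmorphM /= -pmulrn; have := tcount_neq0 r (pr_gamma S).
by move=> h; field.
Qed.

Lemma cell_eq_lattice_shift r P i j tau j' tau' : is_prect P ->
  cell P i j' tau' = lattice_shift r (cell P i j tau) (fun a => (2 ^ (d * r))%N%:Z * (j' a - j a))
     ((tcount r (gamma_at i (pr_gamma P)))%:Z * (tau' - tau)).
Proof.
move=> hP; rewrite /lattice_shift l_t_cell //= /cell; congr PRect.
  apply/rowP => a; rewrite !mxE rmorphM rmorphB /= -pmulrn natrX.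
  by field; rewrite !expf_neq0.
rewrite rmorphM rmorphB /= -pmulrn.
have h := tcount_neq0 r (gamma_at i (pr_gamma P)).
have h' := tcount_neq0 i (pr_gamma P).
by field; rewrite h h'.
Qed.

Hypothesis d0 : (0 < d)%N.

(* This is where p > 1 is used: at depth i the temporal count grows like 2^(dpi),
   the spatial count only like 2^(di). *)
Lemma exists_depth (Phi r : nat) : 1 < p -> exists i1, forall g : R, 0 <= g <= 2^-1 ->
  (Phi * (2 ^ (d * (i1.+1 + r)) + Phi * kmax ^ r + 1) <= tcount i1 g)%N.
Proof.
move=> p1.
set C := (Phi * kmax ^ r + 1)%N.
(* The factor 2 is that of [tcount_lower]; the rest bounds the left-hand side of the claim divided
   by 2^(d * i). *)
pose M : R := 2 * (Phi * (2 ^ (d * r.+1) + C))%N%:R.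
have s2 : 2 ^+ d < s.
  rewrite /two_dp -powR_mulrn // /powR pnatr_eq0 /= ltr_expR.
  by rewrite ltr_pM2r ?ln_gt0 ?ltr1n // ltr_pMr // ltr0n.
pose y := s / 2 ^+ d - 1.
have y0 : 0 < y by rewrite subr_gt0 ltr_pdivlMr ?exprn_gt0 // mul1r.
have [i hi] : exists i : nat, M <= i%:R * y.
  exists (Num.bound (M / y)); rewrite -ler_pdivrMr //; apply/ltW/archi_boundP.
  by rewrite divr_ge0 ?mulr_ge0 // ltW.
exists i => g hg; have low := tcount_lower i hg.
have B : M <= (s / 2 ^+ d) ^+ i.
  have -> : s / 2 ^+ d = 1 + y by rewrite /y addrC subrK.
  by apply: le_trans (@bernoulli R y i _); lra.
rewrite -addnA -/C -(ler_nat R).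
have : (2 ^+ d) ^+ i * M <= s ^+ i.
  by rewrite -ler_pdivlMl ?exprn_gt0 // mulrC -expr_div_n.
suff : (Phi * (2 ^ (d * (i.+1 + r)) + C))%N%:R * 2 <= (2 ^+ d) ^+ i * M by lra.
rewrite /M mulrCA mulrC ler_pM2l // -exprM -natrX -natrM ler_nat mulnCA leq_mul2l; apply/orP; right.
rewrite (mulnDr (2 ^ (d * i))%N) leq_add ?leq_pmull ?expn_gt0 // -expnD -mulnDr leq_exp2l // leq_mul2l.
by apply/orP; right; clear; lia.
Qed.

(** * Holes and their propagation *)

Variable E : set ('rV[R]_n * R).

Definition Efree P : Prop := is_free E (prect_set p P).

Definition hole P a : Prop := exists j tau, in_range P a j tau /\ Efree (cell P a j tau).

Lemma Efree_cell P i j tau : is_prect P -> in_range P i j tau -> Efree P -> Efree (cell P i j tau).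
Proof.
move=> hP hi; rewrite /Efree /is_free => h; rewrite -subset0 => z [/(cell_sub hP hi) h1 h2].
by rewrite -h.
Qed.

Lemma hole_sub P i j tau a : is_prect P -> in_range P i j tau ->
  hole (cell P i j tau) a -> hole P (i + a).
Proof.
move=> hP hi [j' [tau' [h1 h2]]]; do 2 eexists; split; first exact: in_range_cell hi h1.
by rewrite -cell_cell.
Qed.

Lemma hole_split P i a : is_prect P -> hole P (i + a) ->
  exists j tau, in_range P i j tau /\ hole (cell P i j tau) a.
Proof.
move=> hP [j [tau [/in_range_split[j1 [t1 [j2 [t2 [h1 h2 h3 h4]]]]] h]]].
exists j1, t1; split=> //; exists j2, t2; split => //.
by rewrite cell_cell // -(eq_cell P _ h3 h4).
Qed.

Lemma hole_free P a : is_prect P -> Efree P -> hole P a.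
Proof.
move=> hP fP; exists (fun=> 0), 0; split; first exact: in_range0.
by apply: Efree_cell => //; exact: in_range0.
Qed.

Lemma hole_mono P a b : is_prect P -> (a <= b)%N -> hole P a -> hole P b.
Proof.
move=> hP ab [j [tau [h1 h2]]]; rewrite -(subnKC ab).
by apply: (hole_sub hP h1); apply: hole_free => //; exact: is_prect_cell.
Qed.

Lemma dyadicP P Q : is_prect P ->
  dyadic p d P Q <-> exists i j tau, in_range P i j tau /\ Q = cell P i j tau.
Proof.
move=> hP; split=> [[i _ /(dyadic_levelP i Q hP)[j [tau h]]]|[i [j [tau h]]]].
  by exists i, j, tau.
by exists i => //; apply/(dyadic_levelP i Q hP); exists j, tau.
Qed.

(** The ancestor of level b of the first cell shares a point with the second cell, hence equals it
    by [cell_inj]. *)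
Lemma cell_sub_level P i j tau b j' tau' : is_prect P -> (b <= i)%N ->
  in_range P i j tau ->
  prect_set p (cell P i j tau) `&` prect_set p (cell P b j' tau') !=set0 ->
  prect_set p (cell P i j tau) `<=` prect_set p (cell P b j' tau').
Proof.
move=> hP /subnKC e; rewrite -e => /in_range_split[j1 [t1 [j2 [t2 [h1 h2 h3 h4]]]]].
rewrite (eq_cell P _ h3 h4) -cell_cell // => -[z [z1 z2]].
have := z1 => /(cell_sub (is_prect_cell _ _ _ hP) h2) z3.
have [e1 e2] := cell_inj hP z3 z2.
rewrite (eq_cell P b e1 e2) in z1 h2 *.
by apply: cell_sub => //; exact: is_prect_cell.
Qed.

(** Side lengths decrease strictly with the level, so the largest maximal free cells are those of
    the least level b having a hole; such a cell is maximal because a free cell containing it has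
    level at least b. Cells of one level have equal volume, so the volume is the same whichever of
    them [xget] returns. *)
Lemma largest_freeP P a : is_prect P -> hole P a ->
  exists b, [/\ (b <= a)%N, hole P b, (forall b', hole P b' -> (b <= b')%N) &
    vol (largest_free p d E P) = (pr_L P ^+ n * l_t p P / (ncells b (pr_gamma P))%:R)%:E].
Proof.
move=> hP ha.
have ex : exists b, `[<hole P b>] by exists a; apply/asboolP.
case: (ex_minnP ex) => b /asboolP hb bmin'.
have bmin b' : hole P b' -> (b <= b')%N by move=> h; apply: bmin'; apply/asboolP.
exists b; split=> //; first exact: bmin.
have side_gt0 i : 0 < pr_L P / 2 ^+ (d * i) by rewrite divr_gt0 ?exprn_gt0 //; case: hP.
have side_le i j : (i <= j)%N -> pr_L P / 2 ^+ (d * j) <= pr_L P / 2 ^+ (d * i).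
  move=> ij; rewrite ler_pM2l; last by case: hP.
  by rewrite lef_pV2 ?posrE ?exprn_gt0 // ler_eXn2l ?ltr1n // leq_mul2l ij orbT.
rewrite /largest_free; set S := (X in xget _ X).
(* Without a witness [xget] would return its default [set0]. *)
have /xgetPex-/(_ set0) : exists A, S A.
  have [j [tau [h1 h2]]] := hb.
  exists (prect_set p (cell P b j tau)); exists (cell P b j tau) => //; split.
    split=> //; first by apply/dyadicP => //; exists b, j, tau.
    move=> _ /(dyadicP _ hP)[i' [j' [t' [k1 ->]]]] k2 k3; apply/seteqP; split=> //.
    apply: cell_sub_level => //.
      by apply: bmin; exists j', t'.
    have [z hz] := prect_set_neq0 (is_prect_cell b j tau hP).
    by exists z; split=> //; exact: k3.
  move=> Q' [/(dyadicP _ hP)[i' [j' [t' [k1 ->]]]] k2 _].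
  by apply: side_le; apply: bmin; exists j', t'.
case=> Q [[/(dyadicP _ hP)[i [j [tau [k1 ->]]]] k2 k3] k4] <-.
rewrite vol_cell //; suff -> : i = b by [].
have bi : (b <= i)%N by apply: bmin; exists j, tau.
apply/eqP; rewrite eqn_leq bi andbT leqNgt; apply/negP => lt.
have [j' [t' [h1 h2]]] := hb.
have : pr_L (cell P b j' t') <= pr_L (cell P i j tau).
  apply: k4; split=> //; first by apply/dyadicP => //; exists b, j', t'.
  move=> _ /(dyadicP _ hP)[i1 [j1 [t1 [q1 ->]]]] q2 q3; apply/seteqP; split=> //.
  apply: cell_sub_level => //.
    by apply: bmin; exists j1, t1.
  have [z hz] := prect_set_neq0 (is_prect_cell b j' t' hP).
  by exists z; split=> //; exact: q3.
rewrite /= leNgt => /negP; apply.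
rewrite ltr_pM2l; last by case: hP.
by rewrite ltf_pV2 ?posrE ?exprn_gt0 // ltr_eXn2l ?ltr1n // ltn_pmul2l.
Qed.

(** * Weak porosity as a bound on the number of nonfree cells *)

Definition nbad P b : nat := csum P b (fun Q => ~~ `[<Efree Q>] : nat).

(** The family consists of all free cells of level b. *)
Lemma free_family P b (c : R) : is_prect P ->
  (nbad P b)%:R <= (1 - c) * (ncells b (pr_gamma P))%:R ->
  exists (N : nat) (Q : 'I_N -> prect R n),
  [/\ trivIset [set: 'I_N] (fun k => prect_set p (Q k)),
      forall k, dyadic p d P (Q k) /\ is_free E (prect_set p (Q k)),
      forall k, vol (prect_set p (Q k)) =
        (pr_L P ^+ n * l_t p P / (ncells b (pr_gamma P))%:R)%:E &
      (c%:E * vol (prect_set p P) <= \sum_(k < N) vol (prect_set p (Q k)))%E].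
Proof.
move=> hP hb; set g := pr_gamma P in hb *.
pose I := ({ffun 'I_n -> 'I_(2 ^ (d * b))} * 'I_(tcount b g))%type.
pose cl (q : I) := cell P b (fun a => (q.1 a : nat)%:Z) (q.2 : nat)%:Z.
pose F := [pred q : I | `[<Efree (cl q)>]].
have V0 : 0 < pr_L P ^+ n * l_t p P.
  by apply: mulr_gt0; [apply: exprn_gt0; case: hP|exact: l_t_gt0].
have t0 : (0 : R) < (ncells b g)%:R by rewrite ltr0n ncells_gt0.
exists #|F|, (fun k => cl (enum_val k)); split.
- move=> k k' _ _ [z [h1 h2]]; apply: enum_val_inj.
  have [e1 e2] := cell_inj hP h1 h2.
  case: (enum_val k) (enum_val k') e1 e2 => [j1 t1] [j2 t2] /= e1 e2; congr pair.
    by apply/ffunP => a; apply: val_inj; have := e1 a; case.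
  by apply: val_inj; case: e2.
- move=> k; split; last by have := enum_valP k; rewrite inE.
  apply/dyadicP => //; do 3 eexists; split; last by [].
  exact: in_range_ord.
- by move=> k; rewrite vol_cell.
- under eq_bigr do rewrite vol_cell //.
  rewrite sumEFin vol_prect // -EFinM lee_fin sumr_const card_ord -/g.
  have compl : (#|F| + nbad P b = ncells b g)%N.
    rewrite -[RHS]muln1 -(csum_const P b 1) /nbad /csum -sum1_card.
    rewrite !pair_big /= big_mkcond /= -big_split /=.
    by apply: eq_bigr => q _; rewrite inE /cl; case: `[<_>].
  have low : c * (ncells b g)%:R <= #|F|%:R.
    by move: hb; rewrite -compl natrD; lra.
  rewrite -[leRHS]mulr_natr; move: V0; set V := _ * l_t p P => V0.
  rewrite (_ : c * V = V / (ncells b g)%:R * (c * (ncells b g)%:R)).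
    by rewrite ler_pM2l // divr_gt0.
  by field; rewrite gt_eqF.
Qed.

Variables (c0 delta0 : R) (Phi : nat).
Hypothesis hc0 : 0 < c0 < 1.
Hypothesis hdelta0 : 0 < delta0 < 1.
Hypothesis wp : weakly_porous p d c0 delta0 (Phi%:Z)%:~R E.

Lemma porous_hole P : is_prect P -> exists a, hole P a.
Proof.
move=> hP; have [_ _ /(_ P hP)[N [Pk [_ h _ hv]]]] := wp.
case: N Pk h hv => [|N] Pk h hv.
  move: hv; rewrite big_ord0 vol_prect // -EFinM lee_fin leNgt => /negP[].
  case/andP: hc0 => c00 _; case: (hP) => L0 _.
  by apply: mulr_gt0 => //; apply: mulr_gt0; [exact: exprn_gt0|exact: l_t_gt0].
have [/(dyadicP _ hP)[i [j [tau [h1 h2]]]] fr] := h ord0.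
by exists i, j, tau; rewrite -h2.
Qed.

(** A member of the porous family of level above a + r would be smaller than the largest free cell
    of P^Phi by a factor at least 2^(r+1) > 1 / delta0. Hence all members have level at most a + r
    and are unions of cells of that level. *)
Lemma nbad_porous P a r : is_prect P -> delta0^-1 <= 2 ^+ r -> hole (tshift P Phi%:Z) a ->
  (nbad P (a + r))%:R <= (1 - c0) * (ncells (a + r) (pr_gamma P))%:R.
Proof.
move=> hP hr ha; set b := (a + r)%N; set g := pr_gamma P.
case/andP: hdelta0 => dl0 dl1.
have [_ _ /(_ P hP)[N [Pk [triv h hk hv]]]] := wp.
have [a' [aa' _ _ va]] := largest_freeP (is_prect_tshift Phi%:Z hP) ha.
have L0 : 0 < pr_L P by case: hP.
have V0 : 0 < pr_L P ^+ n * l_t p P by rewrite mulr_gt0 ?exprn_gt0 ?l_t_gt0.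
have tot0' i : (0 : R) < (ncells i g)%:R by rewrite ltr0n ncells_gt0.
(* The last bound says that the level-[b] cells inside [Pk q] make up at least its share of the
   volume of [P]. *)
have lev q : exists i, [/\ (i <= b)%N, vol (prect_set p (Pk q)) =
    (pr_L P ^+ n * l_t p P / (ncells i g)%:R)%:E &
    (ncells b g <= ncells i g * csum P b (fun W => `[<prect_set p W `<=` prect_set p (Pk q)>] : nat))%N].
  have [/(dyadicP _ hP)[i [j [tau [h1 h2]]]] fr] := h q.
  have vi : vol (prect_set p (Pk q)) = (pr_L P ^+ n * l_t p P / (ncells i g)%:R)%:E.
    by rewrite h2 vol_cell.
  exists i.
  have ib : (i <= b)%N.
    rewrite leqNgt; apply/negP => bi.
    have := hk q; rewrite vi prect_shiftE va.
    rewrite /tshift l_t_cell //= muln0 expr0 divr1 tcount0 divr1 -EFinM lee_fin -/g.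
    rewrite mulrCA ler_pM2l // ler_pdivrMr // mulrC.
    have -> : i = (a' + (i - a'))%N.
      rewrite subnKC //; apply: leq_trans aa' _.
      by rewrite ltnW // (leq_trans _ bi) // ltnS leq_addr.
    rewrite ncellsD // natrM invfM mulrA divff ?mul1r ?gt_eqF //.
    have t2 : (2 : R) ^+ (r.+1) <= (ncells (i - a') (gamma_at a' g))%:R.
      rewrite -natrX ler_nat; apply: leq_trans (ncells_ge _ _).
      by rewrite leq_exp2l // ; lia.
    rewrite -[leRHS]mul1r ler_pdivlMr; last by apply: lt_le_trans t2; rewrite exprn_gt0.
    move=> hh; have : (2 : R) ^+ r.+1 * delta0 <= 1.
      by apply: le_trans hh; rewrite mulrC ler_pM2l.
    rewrite -ler_pdivlMr // mul1r exprS => h3.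
    have : (0 : R) < 2 ^+ r by rewrite exprn_gt0.
    lra.
  split=> //; set F := fun W => _.
  rewrite -(subnKC ib) ncellsD // leq_mul2l; apply/orP; right.
  rewrite csumD //; apply: leq_trans (csum_ge (fun Q => csum Q (b - i) F) h1).
  rewrite -[leqLHS]muln1 -/(pr_gamma (cell P i j tau)) -(csum_const (cell P i j tau)) -h2.
  apply: leq_csum => j' t' i1; rewrite /F; case: asboolP => // -[]; apply: cell_sub => //.
  by rewrite h2; exact: is_prect_cell.
pose F q W : nat := `[<prect_set p W `<=` prect_set p (Pk q)>].
(* A cell is nonempty, so it lies in at most one of the disjoint [Pk q], whose freeness it
   inherits. *)
have sumle : (\sum_(q < N) csum P b (F q) <= csum P b (fun Q => `[<Efree Q>] : nat))%N.
  rewrite /csum exchange_big /=; apply: leq_sum => j _; rewrite exchange_big /=.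
  apply: leq_sum => t _; set W := cell _ _ _ _.
  have hW : is_prect W by exact: is_prect_cell.
  have [z hz] := prect_set_neq0 hW.
  case: (pickP (fun q => `[<prect_set p W `<=` prect_set p (Pk q)>])) => [q /asboolP hq|no].
    rewrite (bigD1 q) //= big1 ?addn0; last first.
      move=> q' qq'; rewrite /F; case: asboolP => // hq'; case/eqP: qq'.
      by apply: triv => //; exists z; split; [exact: hq'|exact: hq].
    rewrite /F asboolT //; case: asboolP => // -[].
    have [_ fr] := h q; rewrite /Efree /is_free -subset0 => y [/hq y1 y2].
    by move: fr => /seteqP[+ _]; apply.
  by rewrite big1 // => q _; rewrite /F no.
have compl : (csum P b (fun Q => `[<Efree Q>] : nat) + nbad P b = ncells b g)%N.
  rewrite -[RHS]muln1 -(csum_const P b 1) /nbad /csum -big_split /=; apply: eq_bigr => j _.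
  by rewrite -big_split /=; apply: eq_bigr => t _; case: `[<_>].
have -> : (nbad P b)%:R = (ncells b g)%:R - (csum P b (fun Q => `[<Efree Q>] : nat))%:R :> R.
  by rewrite -compl natrD addrAC subrr add0r.
suff : c0 * (ncells b g)%:R <= (csum P b (fun Q => `[<Efree Q>] : nat))%:R by lra.
apply: (@le_trans _ _ (\sum_(q < N) csum P b (F q))%:R); last by rewrite ler_nat.
have : (c0%:E * vol (prect_set p P) <=
    \sum_(q < N) (pr_L P ^+ n * l_t p P * ((csum P b (F q))%:R / (ncells b g)%:R))%:E)%E.
  apply: le_trans hv _; apply: lee_sum => q _.
  have [i [ib -> hi]] := lev q; rewrite lee_fin ler_pM2l // ler_pdivlMr // mulrC ler_pdivrMr // mulrC.
  by rewrite -natrM ler_nat.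
rewrite vol_prect // -EFinM sumEFin lee_fin -mulr_sumr -mulr_suml natr_sum (mulrC c0) ler_pM2l //.
by rewrite ler_pdivlMr.
Qed.

(** Decreasing [delta] requires a nonnegative volume of the largest free cell, which [largest_freeP]
    supplies. *)
Lemma weakly_porous_le delta : delta <= delta0 ->
  weakly_porous p d c0 delta (Phi%:Z)%:~R E.
Proof.
move=> dd; have [E0 Ec wpE] := wp; split=> // P hP.
have [N [Q [h1 h2 h3 h4]]] := wpE P hP; exists N, Q; split=> // k.
apply: le_trans (h3 k).
have hP' := is_prect_tshift Phi%:Z hP.
have [a ha] := porous_hole hP'.
have [b [_ _ _ hv]] := largest_freeP hP' ha.
rewrite prect_shiftE hv -!EFinM lee_fin ler_wpM2r //.
have L0 : 0 < pr_L (tshift P Phi%:Z) by case: hP'.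
by rewrite divr_ge0 // mulr_ge0 ?exprn_ge0 ?ltW // l_t_gt0.
Qed.

(** * Chains of lattice steps backwards in time *)

Variables r rr : nat.
Hypothesis hr : n.+1%:R * (2 / 2 ^+ r) < c0.
Hypothesis r_rr : (r <= rr)%N.
Hypothesis hrr : delta0^-1 <= 2 ^+ rr.

Lemma nbad_nohole Q b : is_prect Q -> ~ hole Q b -> nbad Q b = ncells b (pr_gamma Q).
Proof.
move=> hQ nh; rewrite /nbad -[RHS]muln1 -(csum_const Q b 1).
apply: eq_csum => j tau hi; case: asboolP => // fr; case: nh.
by exists j, tau.
Qed.

(** Every edge is cut into at least 2^r parts, so dropping the two outermost ones loses a proportion
    at most 2 / 2^r in each of n + 1 directions; by Bernoulli and [hr] the total loss is less than
    c0. *)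
Lemma interior_large g : (1 - c0) * (ncells r g)%:R <
  ((2 ^ (d * r) - 2) ^ n * (tcount r g - 2))%N%:R.
Proof.
set x : R := 2 / 2 ^+ r.
have x0 : 0 < x by rewrite divr_gt0 ?exprn_gt0.
have nx : x <= n.+1%:R * x by rewrite ler_peMl ?ler1n // ltW.
have hrx : n.+1%:R * x < c0 := hr.
have x1 : x < 1 by case/andP: hc0; lra.
have key m : (2 ^ r <= m)%N -> m%:R * (1 - x) <= (m - 2)%N%:R /\ (2 <= m)%N.
  move=> rm; have h : (2 : R) ^+ r <= m%:R by rewrite -natrX ler_nat.
  have r2 : (2 : R) <= 2 ^+ r by move: (x1); rewrite /x ltr_pdivrMr ?exprn_gt0 // mul1r; lra.
  have m2 : (2 <= m)%N by rewrite -(ler_nat R); lra.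
  split=> //; rewrite natrB // mulrBr mulr1 lerB // /x mulrA ler_pdivlMr ?exprn_gt0 //.
  by rewrite mulrC ler_pM2r.
have [k1 k1'] : (2 ^ (d * r))%N%:R * (1 - x) <= (2 ^ (d * r) - 2)%N%:R /\ (2 <= 2 ^ (d * r))%N.
  by apply: key; rewrite leq_exp2l // leq_pmull.
have [k2 k2'] : (tcount r g)%:R * (1 - x) <= (tcount r g - 2)%N%:R /\ (2 <= tcount r g)%N.
  by apply: key; apply: leq_trans (tcount_ge r g); case: (r) => // m; rewrite leq_exp2r.
rewrite /ncells !natrM !natrX.
apply: (@lt_le_trans _ _ (((2 ^+ (d * r)) * (1 - x)) ^+ n * ((tcount r g)%:R * (1 - x)))); last first.
  apply: ler_pM => //.
  - by rewrite exprn_ge0 // mulr_ge0 ?exprn_ge0 //; lra.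
  - by rewrite mulr_ge0 //; lra.
  - apply: lerXn2r; rewrite ?nnegrE ?mulr_ge0 ?exprn_ge0 //; first by lra.
    by move: k1; rewrite natrX.
rewrite exprMn.
have := @bernoulli R (- x) n.+1; rewrite exprS => /(_ _)/wrap[]; first by lra.
move=> B.
have T0 : (0 : R) < (2 ^+ (d * r)) ^+ n * (tcount r g)%:R.
  by rewrite mulr_gt0 ?exprn_gt0 // ltr0n tcount_gt0.
rewrite [ltRHS](_ : _ = ((1 - x) * (1 - x) ^+ n) * ((2 ^+ (d * r)) ^+ n * (tcount r g)%:R)); last by ring.
by rewrite ltr_pM2r //; apply: lt_le_trans B; rewrite mulrN; lra.
Qed.

(* The free cells of level a + rr fill a proportion c0 of S^(-Phi), while a
   translation by one level-r step keeps more than 1 - c0 of it. *)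
Lemma hole_step S a zx zt : is_prect S -> hole S a -> (forall i, `|zx i| <= 1) ->
  `|zt + (Phi * tcount r (pr_gamma S))%N%:Z| <= 1 -> hole (lattice_shift r S zx zt) (a + rr).
Proof.
move=> hS ha hx ht.
set g := pr_gamma S in ht *; set b := (a + rr)%N.
pose S' := tshift S (- Phi%:Z).
have hS' : is_prect S' by exact: is_prect_tshift.
have eS : tshift S' Phi%:Z = S by rewrite tshift_tshift // addNr tshift0.
have := nbad_porous hS' hrr; rewrite eS => /(_ _ ha) hb.
pose zt' := zt + (Phi * tcount r g)%N%:Z.
have eT : lattice_shift r S zx zt = lattice_shift r S' zx zt'.
  rewrite lattice_shift_tshift; apply: eq_lattice_shift => //.
  by rewrite /zt' -/g; lia.
rewrite eT; set T := lattice_shift r S' zx zt'.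
have hT : is_prect T by [].
apply: contrapT => nh.
have eb : b = (r + (b - r))%N by rewrite subnKC // (leq_trans r_rr) // leq_addl.
(* Off the boundary layer a unit step keeps the indices in range, so these cells of [S'] also lie in
   [T]. If [T] has no hole of level [b], all their subcells of level [b] are nonfree, too many for
   [nbad_porous]. *)
pose I j tau := [forall i : 'I_n,
    (0 < (j : {ffun 'I_n -> 'I_(2 ^ (d * r))}) i)%N && ((j i).+1 < 2 ^ (d * r))%N]
  && ((0 < (tau : 'I_(tcount r g)))%N && (tau.+1 < tcount r g)%N).
have low : ((\sum_j \sum_tau I j tau) * ncells (b - r) (gamma_at r g) <= nbad S' b)%N.
  rewrite /nbad eb csumD // -eb big_distrl /=; apply: leq_sum => j _.
  rewrite big_distrl /=; apply: leq_sum => tau _.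
  case Ij: (I j tau); rewrite ?mul0n // mul1n.
  move: Ij => /andP[/forallP Ij /andP[t1 t2]].
  set Q := cell _ _ _ _.
  have hQ : is_prect Q by exact: is_prect_cell.
  have eQ : Q = cell T r (fun i => (j i : nat)%:Z - zx i) ((tau : nat)%:Z - zt').
    by rewrite cell_lattice_shift; apply: eq_cell => [i|]; rewrite ?subrK.
  rewrite -/(nbad Q (b - r)) nbad_nohole // => hQb; apply: nh.
  rewrite -/b eb; move: hQb; rewrite eQ; apply: hole_sub => //; split=> [i|].
    by have := hx i; have := Ij i; have := ltn_ord (j i); lia.
  by have := ltn_ord tau; rewrite -/g /= -/g; lia.
have cnt : ((2 ^ (d * r) - 2) ^ n * (tcount r g - 2) <= \sum_j \sum_tau I j tau)%N.
  pose X := [pred x : 'I_(2 ^ (d * r)) | (0 < x)%N && (x.+1 < 2 ^ (d * r))%N].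
  pose Y := [pred x : 'I_(tcount r g) | (0 < x)%N && (x.+1 < tcount r g)%N].
  have -> : (\sum_j \sum_tau I j tau = #|ffun_on X : pred {ffun 'I_n -> 'I_(2 ^ (d * r))}| * #|Y|)%N.
    rewrite -!sum1_card big_distrl /= [RHS]big_mkcond /=; apply: eq_bigr => j _.
    rewrite mul1n [X in if _ then X else _]big_mkcond /=.
    have -> : (j \in ffun_on X) = [forall i, (0 < j i)%N && ((j i).+1 < 2 ^ (d * r))%N].
      by apply/ffun_onP/forallP.
    case h: [forall i, _]; rewrite /I h /=; last by rewrite big1.
    by apply: eq_bigr => tau _; rewrite inE; case: (_ && _).
  rewrite card_ffun_on card_ord leq_mul ?card_interior //.
  by case: (n) => // m; rewrite leq_exp2r // card_interior.
have := interior_large g; rewrite ltNge => /negP; apply.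
have tb : (0 : R) < (ncells (b - r) (gamma_at r g))%:R by rewrite ltr0n ncells_gt0.
rewrite -(ler_pM2r tb) -natrM -mulrA -natrM -ncellsD // -eb.
apply: le_trans hb; rewrite ler_nat -/b.
by apply: leq_trans low; rewrite leq_mul2r cnt orbT.
Qed.

(** Each step goes back by Phi temporal lengths and may correct every coordinate by one unit.
    Correcting always towards the target ([sg]) absorbs offsets of up to N units in N steps. *)
Lemma hole_chain N S a zx zt : is_prect S -> hole S a -> (forall i, `|zx i| <= N%:Z) ->
  `|zt + (N * (Phi * tcount r (pr_gamma S)))%N%:Z| <= N%:Z ->
  hole (lattice_shift r S zx zt) (a + N * rr).
Proof.
elim: N S a zx zt => [|N IH] S a zx zt hS ha hx ht.
  rewrite addn0 -(@eq_lattice_shift r S (fun=> 0) 0) ?lattice_shift0 //.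
    by move=> i; have := hx i; lia.
  by move: ht; rewrite mul0n; lia.
pose sg (z : int) : int := if 0 < z then 1 else if z < 0 then -1 else 0.
have sg1 z : `|sg z| <= 1 by rewrite /sg; case: ifP => //; case: ifP.
have sgN z : `|z| <= N.+1%:Z -> `|z - sg z| <= N%:Z.
  by rewrite /sg; case: ifPn => h1; [|case: ifPn => h2]; lia.
set W := (Phi * tcount r (pr_gamma S))%N in ht.
pose z1x i := sg (zx i).
pose z1t := sg (zt + (N.+1 * W)%N%:Z) - W%:Z.
have h1 : hole (lattice_shift r S z1x z1t) (a + rr).
  by apply: hole_step => // [i|]; [exact: sg1|rewrite -/W /z1t subrK; exact: sg1].
rewrite (_ : lattice_shift r S zx zt =
    lattice_shift r (lattice_shift r S z1x z1t) (fun i => zx i - z1x i) (zt - z1t)).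
  rewrite mulSn addnA; apply: IH => // [i|]; first exact: sgN.
  rewrite -/W; have := sgN _ ht; rewrite /z1t; lia.
rewrite lattice_shiftD; apply: eq_lattice_shift => [i|]; by rewrite addrC subrK.
Qed.

Variable i1 : nat.
Hypothesis hi1 : forall g : R, 0 <= g <= 2^-1 ->
  (Phi * (2 ^ (d * (i1.+1 + r)) + Phi * kmax ^ r + 1) <= tcount i1 g)%N.
Hypothesis Phi2 : (2 <= Phi)%N.

(** [i1.+1] levels lead down to a small cell with a hole; then at most [kmax ^ i1.+1 * D.+1] steps
    follow, each costing [rr] levels. *)
Definition reach_cost (D : nat) : nat := (i1.+1 + (kmax ^ i1.+1 * D.+1) * rr)%N.

(* A chain of N = X / Phi steps between cells of depth i1 + 1, where X is their time
   distance: by [hi1], N exceeds both the spatial distance and the rounding error of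
   the time distance, measured in level-r steps. *)
Lemma hole_reach P a D (j : 'I_n -> int) (tau : int) : is_prect P -> hole P a ->
  (forall i, 0 <= j i < (2 ^ d)%N%:Z) -> - D%:Z <= tau <= -1 ->
  hole (cell P 1 j tau) (a + reach_cost D).
Proof.
move=> hP ha hj ht; set g := pr_gamma P.
have hg : 0 <= g <= 2^-1 by case: hP.
have := hole_mono hP (leq_addl i1.+1 a) ha.
case/(hole_split hP) => js [ts [[hjs hts] hS]].
set S := cell P i1.+1 js ts in hS.
have hT0 : is_prect (cell P 1 j tau) by exact: is_prect_cell.
(* The chain ends at the corner subcell, of the depth of [S], in the cell to be reached. *)
pose jT i := (2 ^ (d * i1))%N%:Z * j i.
pose tT := (tcount i1 (gamma_at 1 g))%:Z * tau.
have eT : cell (cell P 1 j tau) i1 (fun=> 0) 0 = cell P i1.+1 jT tT.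
  by rewrite cell_cell // add1n; apply: eq_cell => [i|]; rewrite addr0.
have := hi1 (gamma_range 1 hg); set K1 := tcount i1 (gamma_at 1 g) => hK1.
set kap := tcount r (gamma_at i1.+1 g).
have kapr : (kap <= kmax ^ r)%N by exact: tcount_le.
have K0 : (K1 <= tcount i1.+1 g <= kmax ^ i1.+1)%N.
  rewrite tcount_le // -add1n tcountD -/K1 leq_pmull //; exact: tcount_gt0.
have /andP[ts0 tsT] := hts; have /andP[tauD tau1] := ht.
have tT1 : tT <= - K1%:Z by rewrite /tT -[leRHS]mulrN1 ler_wpM2l.
have tTD : - tT <= (K1 * D)%N%:Z by rewrite /tT -mulrN PoszM ler_wpM2l // lerNl.
have [X eX] : exists X : nat, X%:Z = ts - tT.
  exists `|ts - tT|%N; rewrite gez0_abs // subr_ge0.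
  apply: le_trans tT1 (le_trans _ ts0).
  by rewrite oppr_le0.
pose N := (X %/ Phi)%N.
have XK : (K1 <= X)%N by rewrite -lez_nat eX -[leLHS]add0r lerD // lerNr.
have XB : (X <= kmax ^ i1.+1 * D.+1)%N.
  case/andP: K0 => K1T TK; rewrite -lez_nat eX (le_trans (lerD (ltW tsT) tTD)) //.
  by rewrite -PoszD lez_nat mulnS leq_add // leq_mul2r (leq_trans K1T) ?orbT.
have NL : (2 ^ (d * (i1.+1 + r)) + Phi * kmax ^ r + 1 <= N)%N.
  by rewrite leq_divRL ?(ltnW Phi2) // mulnC (leq_trans hK1).
have chT : hole (cell P i1.+1 jT tT) (a + N * rr).
  rewrite (cell_eq_lattice_shift r _ js ts) //; apply: hole_chain => //; first exact: is_prect_cell.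
    move=> i; have := hjs i; have := hj i; rewrite /jT.
    move: NL; rewrite mulnDr !expnD mulnS expnD.
    move: (2 ^ (d * i1))%N (2 ^ d)%N (2 ^ (d * r))%N => A1 A2 A3 NL /andP[j0 j1] /andP[js0 js1].
    have h1 : 0 <= A1%:Z * j i by rewrite mulr_ge0.
    have h2 : A1%:Z * j i <= A1%:Z * A2%:Z by rewrite ler_wpM2l // ltW.
    have h3 : `|A1%:Z * j i - js i| <= (A2 * A1)%N%:Z.
      by clear -h1 h2 js0 js1; lia.
    have : `|A3%:Z * (A1%:Z * j i - js i)| <= (A3 * (A2 * A1))%N%:Z.
      by rewrite normrM PoszM ler_wpM2l.
    move=> /le_trans; apply; rewrite lez_nat; apply: leq_trans NL.
    by rewrite -addnA mulnC leq_addr.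
  rewrite /= -/g -/kap.
  have e : X = (N * Phi + X %% Phi)%N by exact: divn_eq.
  have m : (X %% Phi < Phi)%N by rewrite ltn_mod ltnW.
  (* N steps go back by N * Phi lengths of [S] instead of X; the rest is below Phi lengths of [kap]
     lattice steps each, and is left to the corrections. *)
  have -> : kap%:Z * (tT - ts) + (N * (Phi * kap))%N%:Z = - (kap * (X %% Phi))%N%:Z.
    have -> : tT - ts = - X%:Z by rewrite eX opprB.
    by rewrite {1}e PoszD !PoszM; ring.
  rewrite normrN /= lez_nat.
  apply: leq_trans (leq_trans _ NL).
    by apply: (@leq_mul _ _ (kmax ^ r) Phi) => //; rewrite ltnW.
  by rewrite mulnC addnAC leq_addl.
have := chT; rewrite -eT => /(hole_sub hT0 (in_range0 _ _)).
apply: hole_mono => //; rewrite /reach_cost.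
have : (N * rr <= kmax ^ i1.+1 * D.+1 * rr)%N.
  by rewrite leq_mul2r (leq_trans _ XB) ?orbT // leq_div.
by move: (N * rr)%N (_ * rr)%N => x y; clear; lia.
Qed.

(** [Phi * kmax] bounds the time displacement in both [hole_child] and [hole_back]; the successor
    pays for the passage from a child to its parent in [hole_back]. *)
Definition child_cost := (reach_cost (Phi * kmax)).+1.

(** On the level-1 grid of Q^Phi, the Phi-translate of the child has time index m + Phi - k * Phi <=
    -(k - 1)(Phi - 1), which is negative as Phi >= 2. It therefore precedes Q^Phi and [hole_reach]
    applies. *)
Lemma hole_child Q a j m : is_prect Q -> in_range Q 1 j m -> hole (tshift Q Phi%:Z) a ->
  hole (tshift (cell Q 1 j m) Phi%:Z) (a + child_cost).
Proof.
move=> hQ [hj hm] ha.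
have hQ' := is_prect_tshift Phi%:Z hQ.
move: hj hm; rewrite muln1 tcount1; set k := tdiv _ _ _ => hj hm.
have k9 : (9 <= k <= kmax)%N by rewrite tdiv_ge9 // tdiv_le.
have -> : tshift (cell Q 1 j m) Phi%:Z =
    cell (tshift Q Phi%:Z) 1 j (m + Phi%:Z - k%:Z * Phi%:Z).
  rewrite tshift_cell // cell_tshift // tcount1 -/k; apply: eq_cell => //; ring.
have := hole_reach hQ' ha hj (D := Phi * kmax) (tau := m + Phi%:Z - k%:Z * Phi%:Z).
move=> /(_ _)/wrap[]; first by nia.
apply: hole_mono; first exact: (is_prect_cell _ _ _ hQ').
by rewrite /child_cost; lia.
Qed.

Lemma hole_descendant Q a i j m : is_prect Q -> in_range Q i j m -> hole (tshift Q Phi%:Z) a ->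
  hole (tshift (cell Q i j m) Phi%:Z) (a + i * child_cost).
Proof.
move=> hQ; elim: i j m => [|i IH] j m hi ha.
  rewrite addn0 (_ : cell Q 0 j m = Q) //; rewrite -[RHS]cell0.
  case: hi => hj hm; apply: eq_cell => [x|].
    by have := hj x; rewrite muln0 expn0; lia.
  by move: hm; rewrite tcount0; lia.
move: hi; rewrite -addn1 => /in_range_split[j1 [t1 [j2 [t2 [h1 h2 h3 h4]]]]].
rewrite (eq_cell Q _ h3 h4) -cell_cell // mulnDl mul1n addnA.
by apply: hole_child => //; [exact: is_prect_cell|exact: IH].
Qed.

(** The earliest corner child of Q^z has time index -k on the level-1 grid of Q^(z+1). *)
Lemma hole_back Q a z : is_prect Q -> hole (tshift Q (z + 1)) a ->
  hole (tshift Q z) (a + child_cost).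
Proof.
move=> hQ ha; have hQ' := is_prect_tshift (z + 1) hQ.
set k := tdiv p d (pr_gamma Q).
have k9 : (9 <= k <= kmax)%N by rewrite tdiv_ge9 // tdiv_le.
have h1 (i : 'I_n) : 0 <= (0 : int) < (2 ^ d)%N%:Z by rewrite lexx /= ltz_nat expn_gt0.
have h2 : - (Phi * kmax)%N%:Z <= - k%:Z <= -1 by nia.
have := hole_reach hQ' ha h1 h2.
have -> : cell (tshift Q (z + 1)) 1 (fun=> 0) (- k%:Z) = cell (tshift Q z) 1 (fun=> 0) 0.
  by rewrite !cell_tshift // tcount1 -/k; apply: eq_cell => //; ring.
move=> /(hole_sub (is_prect_tshift z hQ) (in_range0 _ _)).
by rewrite /child_cost addnS add1n.
Qed.

Lemma hole_back_iter Q a m : is_prect Q -> hole (tshift Q (Phi + m)%N%:Z) a ->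
  hole (tshift Q Phi%:Z) (a + m * child_cost).
Proof.
move=> hQ; elim: m a => [|m IH] a; first by rewrite !addn0.
rewrite addnS -addn1 PoszD => /(hole_back hQ)/IH.
by rewrite mulSn addnA.
Qed.

(** * Exponential decay of the nonfree part *)

Variables N u : nat.
Hypothesis hN : 4 * Phi%:R <= c0 * N%:R.
Hypothesis hu : 4 * N.+1%:R <= c0 * 9 ^+ u.

Local Notation q := child_cost.

(** [rr] is the loss in [nbad_porous]; [N * q] pays for carrying a hole back through a window of N
    translates, and [u + u * q] for handing the hole of P^Phi down to cells of level below [u]. The
    further [q.+1] in [decay_depth] is one more child step together with its level. *)
Definition lag_depth : nat := (rr + N * q + u + u * q)%N.
Definition decay_depth : nat := (lag_depth + q.+1)%N.

Lemma nbad_le_ncells P b : (nbad P b <= ncells b (pr_gamma P))%N.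
Proof.
by rewrite -[leqRHS]muln1 -(csum_const P b 1); apply: leq_csum => // j t _; case: `[<_>].
Qed.

Lemma nbad_free Q b : is_prect Q -> Efree Q -> nbad Q b = 0%N.
Proof.
move=> hQ fr; rewrite -[RHS](muln0 (ncells b (pr_gamma Q))) -(csum_const Q b 0).
by apply: eq_csum => j t hi; rewrite asboolT //; apply: Efree_cell.
Qed.

Lemma csum_ler P i (F G : prect R n -> nat) (c : R) :
  (forall j t, in_range P i j t -> (F (cell P i j t))%:R <= c * (G (cell P i j t))%:R) ->
  (csum P i F)%:R <= c * (csum P i G)%:R.
Proof.
move=> h; rewrite /csum !natr_sum mulr_sumr; apply: ler_sum => j _.
by rewrite !natr_sum mulr_sumr; apply: ler_sum => t _; apply: h; exact: in_range_ord.
Qed.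

Section Marked.
Variables (P : prect R n) (L : nat).
Hypothesis hP : is_prect P.
Hypothesis hL : hole (tshift P Phi%:Z) L.
Local Notation g := (pr_gamma P).
Local Notation e := (L + rr)%N.
Local Notation l := (L + lag_depth)%N.

(* For Q of level i in P; levels are counted from P, hence the subtraction. *)
Definition stopped i Q : Prop := ~ hole (tshift Q Phi%:Z) (l - i).

(** The cells of level [e] that may still contain nonfree cells or lie in a region where the
    argument restarts; unmarked ones are free. *)
Definition marked (W : prect R n) : Prop := ~ Efree W \/
  exists i j t j' t', [/\ (i < e)%N, in_range P i j t, stopped i (cell P i j t),
    in_range (cell P i j t) (e - i) j' t' & W = cell (cell P i j t) (e - i) j' t'].

(* The alternative comes from a stopped ancestor Q at level i: the window is made of
   the Q^z with Phi <= z <= N. A hole there would propagate back to Q^Phi, and [hL]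
   excludes i < u, so that the window is short compared with P. *)
Lemma marked_column (j : 'I_n -> int) t : in_range P e j t%:Z -> marked (cell P e j t%:Z) ->
  ~ Efree (cell P e j t%:Z) \/
  exists a k, [/\ (a <= t < a + k)%N,
     (forall t', (a + Phi * k <= t' < a + N.+1 * k)%N -> ~ Efree (cell P e j t'%:Z)) &
     (N.+1 * k <= (N.+1 * tcount e g) %/ 9 ^ u)%N].
Proof.
move=> hjt [nf|[i [jq [tq [j' [t' [ie hq st hj' eW]]]]]]]; [by left|right].
set Q := cell P i jq tq in st hj' eW.
have hQ : is_prect Q by exact: is_prect_cell.
have ee : e = (i + (e - i))%N by rewrite subnKC // ltnW.
set k := tcount (e - i) (gamma_at i g).
have k0 : (0 < k)%N by exact: tcount_gt0.
have eK : tcount e g = (tcount i g * k)%N by rewrite {1}ee tcountD.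
have [ej et] : j =1 (fun x => (2 ^ (d * (e - i)))%N%:Z * jq x + j' x) /\ t%:Z = k%:Z * tq + t'.
  have [z hz] := prect_set_neq0 (is_prect_cell e j t%:Z hP).
  by apply: (cell_inj hP hz); move: hz; rewrite eW cell_cell // -ee.
have [_ tq0] := hq; have [_ t'0] := hj'.
have iu : (u <= i)%N.
  rewrite leqNgt; apply/negP => iu; apply: st.
  apply: hole_mono (hole_descendant hP hq hL).
    exact: is_prect_tshift.
  have : (i * q <= u * q)%N by rewrite leq_mul2r ltnW ?orbT.
  by rewrite /lag_depth; clear -iu; lia.
(* In units of level-[e] cells, Q starts at [k * tq] and has temporal length [k]. *)
exists (k * `|tq|)%N, k; split.
- by move: t'0 => /=; rewrite -/k; clear -et tq0; nia.
- move=> t1 ht1 fr; apply: st.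
  (* The free cell at time [t1] lies in the translate Q^[th]. *)
  pose th := (t1 %/ k - `|tq|)%N.
  have h1 : (`|tq| + Phi <= t1 %/ k)%N by rewrite leq_divRL //; clear -ht1; lia.
  have h2 : (t1 %/ k < `|tq| + N.+1)%N by rewrite ltn_divLR //; clear -ht1; lia.
  have eth : th = (Phi + (th - Phi))%N by rewrite /th; clear -h1; lia.
  have ht : hole (tshift Q th%:Z) (e - i).
    exists j', (t1 %% k)%N%:Z; split.
      by case: hj' => hj' _; split=> //; rewrite /= -/k ltz_nat ltn_mod k0.
    rewrite cell_tshift // cell_cell // -ee.
    move: fr; congr Efree; apply: eq_cell => //=.
    by have := divn_eq t1 k; rewrite -/k /th; clear -h1 tq0; nia.
  move: ht; rewrite eth => /(hole_back_iter hQ).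
  apply: hole_mono; first exact: is_prect_tshift.
  have : ((th - Phi) * q <= N * q)%N by rewrite leq_mul2r; apply/orP; right; rewrite /th; clear -h2; lia.
  by rewrite /lag_depth; clear -ie; lia.
- rewrite leq_divRL ?expn_gt0 // eK -mulnA leq_mul2l /= mulnC leq_mul2r.
  apply/orP; right; apply: leq_trans (tcount_ge i g).
  by rewrite leq_exp2l.
Qed.

(** [lagged_rising_sun] is applied in each time column. The windows overrun P by a proportion at
    most (N + 1) / 9^u <= c0 / 4, and the nonfree cells of P have proportion at most 1 - c0 by
    [nbad_porous]. *)
Lemma marked_count :
  (csum P e (fun W => `[<marked W>] : nat))%:R <= (1 - c0 / 2) * (ncells e g)%:R.
Proof.
set K := tcount e g; set D := ((2 ^ (d * e)) ^ n)%N.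
set e' := ((N.+1 * K) %/ 9 ^ u)%N.
have col (j : {ffun 'I_n -> 'I_(2 ^ (d * e))}) :
  ((N - Phi) * \sum_(t < K) `[<marked (cell P e (fun x => (j x : nat)%:Z) (t : nat)%:Z)>] <=
   N * (\sum_(t < K) ~~ `[<Efree (cell P e (fun x => (j x : nat)%:Z) (t : nat)%:Z)>] + e'))%N.
  pose A t := `[<marked (cell P e (fun x => (j x : nat)%:Z) t%:Z)>].
  pose B t := ~~ `[<Efree (cell P e (fun x => (j x : nat)%:Z) t%:Z)>].
  have -> : (\sum_(t < K) `[<marked (cell P e (fun x => (j x : nat)%:Z) (t : nat)%:Z)>] =
      \sum_(0 <= t < K) A t)%N by rewrite big_mkord.
  have -> : (\sum_(t < K) ~~ `[<Efree (cell P e (fun x => (j x : nat)%:Z) (t : nat)%:Z)>] =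
      \sum_(0 <= t < K) B t)%N by rewrite big_mkord.
  have := @lagged_rising_sun A B Phi N K e' => /(_ _)/wrap[].
    move=> t tK /asboolP mt.
    have [nf|[a [k [h1 h2 h3]]]] :=
      marked_column (in_range_ord j (Ordinal tK) : in_range P e (fun x => (j x : nat)%:Z) t%:Z) mt.
    - by left; apply/asboolPn.
    - by right; exists a, k; split=> // t1 /h2 nf; apply/asboolPn.
  move=> /leq_trans; apply; rewrite leq_mul2l; apply/orP; right.
  have -> : (\sum_(0 <= t < K + e') B t = \sum_(0 <= t < K) B t + \sum_(K <= t < K + e') B t)%N.
    by apply: big_cat_nat => //; exact: leq_addr.
  rewrite leq_add2l; apply: leq_trans (_ : _ <= \sum_(K <= t < K + e') 1)%N _.
    by apply: leq_sum => t _; case: (B t).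
  by rewrite sum_nat_const_nat muln1 addKn.
have total : ((N - Phi) * csum P e (fun W => `[<marked W>] : nat) <= N * (nbad P e + D * e'))%N.
  rewrite /csum big_distrr /=.
  apply: leq_trans (leq_sum _ (fun j _ => col j)) _.
  by rewrite -big_distrr /= big_split /= sum_nat_const card_ffun !card_ord.
case/andP: hc0 => c00 c01; have hN1 := hN.
have N0 : (0 : R) < N%:R.
  have : (0 : R) < Phi%:R by rewrite ltr0n ltnW.
  by move: hN; move: (N%:R : R) => x hx y; nra.
have PN : (Phi <= N)%N.
  have cN : c0 * N%:R <= N%:R by rewrite ler_piMl // ltW.
  have P0 : (0 : R) <= Phi%:R by [].
  by rewrite -(ler_nat R); lra.
have nb := nbad_porous hP hrr hL.
have he' : (D * e')%N%:R <= c0 / 4 * (ncells e g)%:R :> R.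
  rewrite /ncells natrM [in leRHS]natrM -/D -/K mulrCA ler_wpM2l //.
  have : ((e' * 9 ^ u)%N%:R : R) <= (N.+1 * K)%N%:R by rewrite ler_nat leq_trunc_div.
  rewrite !natrM natrX => h.
  have : (0 : R) < 9 ^+ u by rewrite exprn_gt0.
  have : 0 <= K%:R :> R by [].
  have : 4 * N.+1%:R * K%:R <= c0 * 9 ^+ u * K%:R :> R by rewrite ler_wpM2r.
  move: h; move: (e'%:R : R) (9 ^+ u : R) (K%:R : R) (N.+1%:R : R) => a b c f h1 h2 h3 h4.
  rewrite -(ler_pM2r h4); lra.
have := total; rewrite -(ler_nat R) natrM natrB // natrM natrD => tt.
set A := (csum _ _ _)%:R in tt *; set t := (ncells e g)%:R in nb he' *.
have A0 : 0 <= A by [].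
have t0 : 0 <= t by [].
have h1 : N%:R * (1 - c0 / 4) * A <= (N%:R - Phi%:R) * A by rewrite ler_wpM2r //; lra.
have h2 : N%:R * (nbad P e)%:R + N%:R * (D * e')%N%:R <= N%:R * ((1 - c0) * t + c0 / 4 * t).
  by rewrite -mulrDr ler_pM2l // lerD.
have h3 : (1 - c0 / 4) * A <= (1 - c0 * 3 / 4) * t.
  rewrite -(ler_pM2l N0); move: tt; rewrite mulrDr; lra.
(* Dividing by 1 - c0 / 4, a lower bound for 1 - Phi / N, still leaves 1 - c0 / 2. *)
have h4 : (1 - c0 * 3 / 4) * t <= (1 - c0 / 4) * ((1 - c0 / 2) * t).
  by rewrite mulrA ler_wpM2r //; nra.
rewrite -(@ler_pM2l _ (1 - c0 / 4)); [exact: le_trans h3 h4|lra].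
Qed.

(* Unstopped cells pass a hole of bounded depth on to their children, so [IH] applies
   to every maximal stopped cell and to every remaining nonfree cell of level e. *)
Lemma marked_tree J X : (e + X = l + q.+1 + J * decay_depth)%N ->
  (forall Q L', is_prect Q -> hole (tshift Q Phi%:Z) L' ->
     (nbad Q (L' + J * decay_depth))%:R <=
       (1 - c0 / 2) ^+ J * (ncells (L' + J * decay_depth) (pr_gamma Q))%:R) ->
  (nbad P (e + X))%:R <= (1 - c0 / 2) ^+ J * (ncells X (gamma_at e g))%:R *
     (csum P e (fun W => `[<marked W>] : nat))%:R.
Proof.
move=> eX IH; set rho := (1 - c0 / 2) ^+ J; set F := fun W => _.
have rho0 : 0 <= rho by case/andP: hc0 => a b; rewrite exprn_ge0 //; lra.
have el : (e <= l)%N by rewrite /lag_depth; clear; lia.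
(* Induction on the number [f] of levels down to [e]; the hole hypothesis is kept one child step
   deeper than the stopping level, as inherited from an unstopped parent. *)
have gen f : forall i j t, (i + f = e)%N -> in_range P i j t ->
  hole (tshift (cell P i j t) Phi%:Z) (l + q.+1 - i) ->
  (nbad (cell P i j t) (f + X))%:R <= rho * (ncells X (gamma_at e g))%:R * (csum (cell P i j t) f F)%:R.
  elim: f => [|f IHf] i j t ie hi hh; have hQ := is_prect_cell i j t hP.
    rewrite addn0 in ie; subst i; rewrite csum0 // /F add0n.
    have [fr|nfr] := pselect (Efree (cell P e j t)).
      by rewrite nbad_free // mulr_ge0 // mulr_ge0.
    rewrite asboolT ?mulr1; last by left.
    have -> : X = (l + q.+1 - e + J * decay_depth)%N by clear -eX el; lia.
    exact: IH.
  set Q := cell P i j t in hQ hh *.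
  have [st|us] := pselect (stopped i Q).
    (* Below a stopped cell every cell of level [e] is marked. *)
    have -> : csum Q f.+1 F = ncells f.+1 (gamma_at i g).
      rewrite -[RHS]muln1 -[gamma_at i g]/(pr_gamma Q) -(csum_const Q f.+1 1).
      apply: eq_csum => j' t' hj'; rewrite /F asboolT //; right.
      by exists i, j, t, j', t'; rewrite -ie addKn addnS ltnS leq_addr; split.
    have -> : (f.+1 + X = l + q.+1 - i + J * decay_depth)%N by clear -eX el ie; lia.
    apply: le_trans (IH _ _ hQ hh) _; rewrite -/rho -mulrA ler_wpM2l //.
    have -> : (l + q.+1 - i + J * decay_depth = f.+1 + X)%N by clear -eX el ie; lia.
    by rewrite -[pr_gamma Q]/(gamma_at i g) ncellsD -gamma_atD ie natrM mulrC.
  have {}us : hole (tshift Q Phi%:Z) (l - i) by exact: contrapT.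
  rewrite -add1n -addnA /nbad !csumD //.
  apply: csum_ler => j' t' hj'; rewrite /Q cell_cell // -/(nbad _ _).
  apply: IHf; first by clear -ie; lia.
    exact: in_range_cell hi hj'.
  rewrite -cell_cell // -/Q.
  have -> : (l + q.+1 - (i + 1) = l - i + q)%N by clear -el ie; lia.
  exact: hole_child.
have eP : cell P 0 (fun=> 0) 0 = P by exact: cell0.
have := @gen e 0%N (fun=> 0) 0 (add0n _) (in_range0 _ _); rewrite eP; apply.
by apply: hole_mono hL; [exact: is_prect_tshift|clear; lia].
Qed.

End Marked.

Lemma nbad_decay J P L : is_prect P -> hole (tshift P Phi%:Z) L ->
  (nbad P (L + J * decay_depth))%:R <=
  (1 - c0 / 2) ^+ J * (ncells (L + J * decay_depth) (pr_gamma P))%:R.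
Proof.
elim: J P L => [|J IH] P L hP hL.
  by rewrite expr0 mul1r mul0n addn0 ler_nat nbad_le_ncells.
have rho0 : 0 <= (1 - c0 / 2) ^+ J by case/andP: hc0 => a b; rewrite exprn_ge0 //; lra.
(* [X] levels remain below the level [L + rr] at which cells are marked. *)
pose X := (L + lag_depth + q.+1 + J * decay_depth - (L + rr))%N.
have eX : (L + rr + X = L + lag_depth + q.+1 + J * decay_depth)%N by rewrite /X /lag_depth; clear; lia.
have -> : (L + J.+1 * decay_depth = L + rr + X)%N by rewrite eX mulSn /decay_depth; clear; lia.
apply: le_trans (marked_tree hP hL eX IH) _.
rewrite exprSr ncellsD // natrM -!mulrA ler_wpM2l // [leRHS]mulrA [leRHS]mulrC ler_wpM2l //.
exact: marked_count.
Qed.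

(** The largest free cell of P^Phi has the least level L of a hole, the cells used have level L + J
    * [decay_depth]; their volume ratio is the inverse of a cell count bounded by [ncells_le]. *)
Lemma weakly_porous_decay J delta :
  delta <= ((((2 ^ d) ^ n * kmax) ^ decay_depth)%N%:R^-1) ^+ J ->
  weakly_porous p d (1 - (1 - c0 / 2) ^+ J) delta (Phi%:Z)%:~R E.
Proof.
move=> hdel; have [E0 Ec _] := wp; split=> // P hP.
have hP' := is_prect_tshift Phi%:Z hP.
have [a ha] := porous_hole hP'.
have [L [_ hL _ hv]] := largest_freeP hP' ha.
have := nbad_decay J hP hL.
rewrite -(subKr 1 ((1 - c0 / 2) ^+ J)) => /(free_family hP)[M [Q [h1 h2 h3]]].
rewrite !subKr => h4.
exists M, Q; split=> // k.
rewrite h3 prect_shiftE hv -EFinM lee_fin.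
rewrite /tshift l_t_cell //= muln0 expr0 divr1 tcount0 divr1.
set g := pr_gamma P.
have V0 : 0 < pr_L P ^+ n * l_t p P.
  by apply: mulr_gt0; [apply: exprn_gt0; case: hP|exact: l_t_gt0].
rewrite mulrCA ler_pM2l // ncellsD // natrM invfM mulrC ler_pM2l; last first.
  by rewrite invr_gt0 ltr0n ncells_gt0.
apply: le_trans hdel _; rewrite exprVn lef_pV2 ?posrE ?ltr0n ?ncells_gt0 //; last first.
  rewrite exprn_gt0 // ltr0n !expn_gt0 muln_gt0 !expn_gt0 /=.
  by rewrite (leq_trans (tdiv_gt0 0) (tdiv_le 0)).
rewrite -natrX ler_nat -expnM mulnC; exact: ncells_le.
Qed.

End ParabolicLattice.

(** * Choice of the constants and of the exponent *)

Theorem lemma7p1 (R : realType) (n d : nat) (p : R)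
    (theta0 phi Phi : int) (c0 delta0 : R)
    (hn : (1 <= n)%N) (hp : 1 < p) (hd : (1 <= d)%N)
    (hdp : ln 9 / ln 2 <= d%:R * p)
    (hparams : admissible p d theta0 phi Phi)
    (hc0 : 0 < c0 < 1) (hdelta0 : 0 < delta0 < 1) :
  exists alpha : R, 0 < alpha /\
    forall E : set ('rV[R]_n * R),
      weakly_porous p d c0 delta0 Phi%:~R E ->
      alpha_improving p d c0 delta0 Phi%:~R alpha E.
Proof.
have s9 : 9 <= two_dp p d.
  rewrite /two_dp /powR pnatr_eq0 /= -[leLHS]lnK ?posrE // ler_expR.
  by rewrite -ler_pdivrMr // ln_gt0 // ltr1n.
have [[_ _ Phi2'] _ _ _ _] := hparams.
case: Phi Phi2' {hparams} => // Phi Phi2.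
have {}Phi2 : (2 <= Phi)%N by rewrite -lez_nat.
have [c00 c01] := andP hc0; have [dl0 dl1] := andP hdelta0.
have pow_ge (x : R) : exists m, x <= 2 ^+ m.
  by exists (Num.bound x); apply/ltW/upper_nthrootP.
have [r hr] : exists r, n.+1%:R * (2 / 2 ^+ r) < c0.
  have [r hr] := pow_ge (4 * n.+1%:R / c0); exists r.
  move: hr; rewrite ler_pdivrMr // mulrA ltr_pdivrMr ?exprn_gt0 // => hr.
  have : (0 : R) < n.+1%:R by rewrite ltr0n.
  by lra.
have [rr0 hrr0] := pow_ge delta0^-1.
pose rr := maxn r rr0.
have hrr : delta0^-1 <= 2 ^+ rr.
  by apply: le_trans hrr0 _; rewrite ler_eXn2l ?ltr1n // leq_maxr.
have [i1 hi1] := exists_depth s9 hd Phi r hp.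
have [N0 hN0] := pow_ge (4 * Phi%:R / c0); pose N := (2 ^ N0)%N.
have hN : 4 * Phi%:R <= c0 * N%:R.
  by move: hN0; rewrite ler_pdivrMr // [leRHS]mulrC -natrX.
have [u hu0] := pow_ge (4 * N.+1%:R / c0).
have hu : 4 * N.+1%:R <= c0 * 9 ^+ u.
  move: hu0; rewrite ler_pdivrMr // [leRHS]mulrC => /le_trans; apply.
  by rewrite ler_pM2l // lerXn2r ?nnegrE //; lra.
pose sigma := decay_depth d p Phi rr i1 N u.
pose B := (((2 ^ d) ^ n * kmax d p) ^ sigma)%N.
have B2 : (2 <= B)%N.
  apply: (@leq_trans (2 ^ sigma)); first by rewrite -{1}(expn1 2) leq_exp2l // /sigma /decay_depth addnS.
  rewrite leq_exp2r ?/sigma /decay_depth ?addnS // -[2%N]mul1n leq_mul ?expn_gt0 //.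
  by apply: leq_trans (tdiv_le s9 0); apply: leq_trans (tdiv_ge9 s9 0).
pose beta : R := B%:R^-1.
have Bb : 0 < beta <= 2^-1.
  by rewrite invr_gt0 ltr0n (leq_trans _ B2) //= lef_pV2 ?posrE ?ltr0n ?ler_nat // (leq_trans _ B2).
pose rho := 1 - c0 / 2.
have rho01 : 0 < rho < 1 by rewrite /rho; lra.
have [b0 b2] := andP Bb; have [r0 r1] := andP rho01.
have lnb : ln beta < 0 by apply: ln_lt0; lra.
have lnr : ln rho < 0 by apply: ln_lt0.
(* With this exponent beta^alpha = rho: a loss of one factor beta in [delta] gains one factor rho in
   1 - c. It is fixed before E. *)
pose alpha := ln rho / ln beta.
have a0 : 0 < alpha by rewrite /alpha -mulrNN -invrN divr_gt0 // oppr_gt0.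
have balpha : beta `^ alpha = rho.
  by rewrite /powR gt_eqF // divfK ?lnK ?posrE // lt_eqF.
exists alpha; split=> // E wp; split=> //.
exists rho^-1; first by rewrite invr_gt0.
move=> delta /andP[del0 del1].
have exJ : exists J, beta ^+ J < delta.
  have [m hm] := pow_ge (2 / delta); exists m.
  apply: (@le_lt_trans _ _ (2^-1 ^+ m)); first by apply: lerXn2r; rewrite ?nnegrE // ltW.
  rewrite exprVn -div1r ltr_pdivrMr ?exprn_gt0 //.
  by move: hm; rewrite ler_pdivrMr // mulrC; lra.
(* For J + 1 minimal with beta^(J+1) < delta, this bound gives rho^(J+1) <= delta^alpha, whence K =
   1 / rho, while minimality gives delta <= beta^J as [weakly_porous_decay] requires. *)
case: (ex_minnP exJ) => [[|J]] hJ minJ.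
  by move: hJ; rewrite expr0; lra.
have dJ : delta <= beta ^+ J.
  by rewrite leNgt; apply/negP => /minJ; rewrite ltnn.
have hK : rho ^+ J <= rho^-1 * delta `^ alpha.
  rewrite mulrC ler_pdivlMr // -exprSr -balpha -powR_mulrn ?powR_ge0 // powRAC.
  rewrite powR_mulrn ?(ltW b0) //; apply: ge0_ler_powR; rewrite ?nnegrE ?ltW //.
  by rewrite exprn_gt0.
(* For J = 0 the decay would give c = 0, which is excluded; c0 itself serves, since 1 - c0 < 1 <= K
   * delta^alpha. *)
case: J {hJ minJ} dJ hK => [|J] dJ hK.
  exists c0; split=> //; first by move: hK; rewrite expr0; lra.
  exact: (weakly_porous_le s9 hd hc0 wp del1).
exists (1 - rho ^+ J.+1); split.
- have : rho ^+ J.+1 < 1 by rewrite exprn_ilt1 // ltW.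
  have : 0 < rho ^+ J.+1 by rewrite exprn_gt0.
  by lra.
- by rewrite subKr.
- exact: (weakly_porous_decay s9 hd hc0 hdelta0 wp hr (leq_maxl _ _) hrr hi1 Phi2 hN hu).
Qed.
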